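(* Let $U\in\mathrm{SpSt}(2n,2k)$, $\Delta\in T_U\mathrm{SpSt}(2n,2k)$ and $M\in\pi^{-1}(U)\subset\mathrm{Sp}(2n,\mathbb{R})$. Then the geodesic, with respect to the Riemannian metric $g^{\mathrm{SpSt}}$, from $U$ in direction $\Delta$ is given by $$\mathrm{Exp}^{\mathrm{SpSt},g}_U(t\Delta):=\pi\big(\mathrm{Exp}^{\mathrm{Sp},g}_M(t\Delta^{\mathrm{hor},g}_M)\big)=\exp\big(t(\bar\Omega(\Delta)-\bar\Omega(\Delta)^T)\big)\exp\big(t\bar\Omega(\Delta)^T\big)U,$$ where $$\bar\Omega(\Delta)=\Delta(U^TU)^{-1}U^T+J_{2n}U(U^TU)^{-1}\Delta^T\left(I_{2n}-J_{2n}^TU(U^TU)^{-1}U^TJ_{2n}\right)J_{2n}.$$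
   Context: Let $k\le n$ be positive integers, $J_{2m}=\begin{bmatrix}0&I_m\\-I_m&0\end{bmatrix}$, and for a real $2a\times 2b$ matrix $A$ put $A^+:=J_{2b}^TA^TJ_{2a}$ (symplectic inverse). $\mathrm{Sp}(2n,\mathbb{R})=\{M\in\mathbb{R}^{2n\times 2n}: M^+M=I_{2n}\}$, with Lie algebra $\mathfrak{sp}(2n,\mathbb{R})=\{\Omega:\Omega^+=-\Omega\}$. $\mathrm{SpSt}(2n,2k)=\{U\in\mathbb{R}^{2n\times2k}:U^+U=I_{2k}\}$, with tangent spaces $T_U\mathrm{SpSt}(2n,2k)=\{\Delta\in\mathbb{R}^{2n\times2k}: U^+\Delta\in\mathfrak{sp}(2k,\mathbb{R})\}$. Let $I_{n,k}=\begin{bmatrix}I_k\\0\end{bmatrix}\in\mathbb{R}^{n\times k}$, $E=\begin{bmatrix}I_{n,k}&0\\0&I_{n,k}\end{bmatrix}\in\mathbb{R}^{2n\times2k}$, and $\pi:\mathrm{Sp}(2n,\mathbb{R})\to\mathrm{SpSt}(2n,2k)$, $\pi(M)=ME$. $\mathrm{Sp}(2n,\mathbb{R})$ carries the right-invariant Riemannian metric $g_M(X_1,X_2)=\frac12\mathrm{tr}\big((X_1M^+)^TX_2M^+\big)$, and the geodesic from $M$ in direction $X\in T_M\mathrm{Sp}(2n,\mathbb{R})$ is $\mathrm{Exp}^{\mathrm{Sp},g}_M(tX)=\exp\big(t(XM^+-(XM^+)^T)\big)\exp\big(t(XM^+)^T\big)M$ ($\exp$ is the matrix exponential). For $\Delta\in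 T_{\pi(M)}\mathrm{SpSt}(2n,2k)$, the horizontal lift with respect to $\pi$ and $g$ is $\Delta^{\mathrm{hor},g}_M=\bar\Omega(\Delta)M$. The Riemannian metric on $\mathrm{SpSt}(2n,2k)$, for which $\pi$ is a Riemannian submersion, is $$g^{\mathrm{SpSt}}_U(\Delta_1,\Delta_2)=\mathrm{tr}\left(\Delta_1^T\left(I_{2n}-\tfrac12J_{2n}^TU(U^TU)^{-1}U^TJ_{2n}\right)\Delta_2(U^TU)^{-1}\right).$$ *)

(* Defs.v *)
From mathcomp Require Import all_boot all_order all_algebra.
From mathcomp Require Import all_classical all_reals all_analysis.

Set Implicit Arguments.
Unset Strict Implicit.
Unset Printing Implicit Defensive.

Import Order.TTheory GRing.Theory Num.Theory.
Import numFieldNormedType.Exports.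

Local Open Scope classical_set_scope.
Local Open Scope ring_scope.

Section MatrixExponential.
Variables (R : realType) (n : nat).
Implicit Type A : 'M[R]_n.

Definition expmx A : 'M[R]_n :=
  limn (series (fun i : nat => (i`!%:R)^-1 *: (A ^+ i))).

End MatrixExponential.

(* Riemannian geometry of an embedded submanifold S of the vector space of    *)
(* p x q matrices. T x is the tangent space of S at x, g x the inner product  *)
(* on T x. A connection on S is written in ambient coordinates as             *)
(*   nabla_X Y = dY(X) + Gamma(X, Y),                                         *)
(* with Gamma_x : T x * T x -> 'M_(p, q) bilinear (the values of Gamma need   *)
(* not be tangent: the sum is). Only the values of Gamma at points of S and   *)
(* on tangent vectors are meaningful.                                         *)
Section EmbeddedRiemannian.
Variables (R : realType) (p q : nat).
Local Notation E := 'M[R]_(p, q).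
Variables (S : set E) (T : E -> set E) (g : E -> E -> E -> R).
Implicit Types (I : set R) (c V W : R -> E) (Gamma : E -> E -> E -> E).

Definition smooth_on I c :=
  forall (m : nat) (t : R), I t -> derivable (derive1n m c) t 1.

Definition smooth_curve_on I c := smooth_on I c /\ (forall t, I t -> S (c t)).

Definition tangent_field_on I c V :=
  smooth_on I V /\ (forall t, I t -> T (c t) (V t)).

Definition covariant_derivative Gamma c V (t : R) : E :=
  derive1 V t + Gamma (c t) (derive1 c t) (V t).

(* The symmetry clause is torsion-freeness: for tangent vector fields,        *)
(* nabla_X Y - nabla_Y X - [X, Y] = Gamma(X, Y) - Gamma(Y, X).                *)
(* Smoothness of Gamma is not required separately: by the Koszul formula the  *)
(* clauses below determine Gamma on tangent vectors.                          *)
Definition is_levi_civita Gamma :=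
  [/\ (forall x X X' Y (a : R), S x -> T x X -> T x X' -> T x Y ->
         Gamma x (a *: X + X') Y = a *: Gamma x X Y + Gamma x X' Y),
      (forall x X Y, S x -> T x X -> T x Y -> Gamma x X Y = Gamma x Y X),
      (forall I c V, open I -> smooth_curve_on I c -> tangent_field_on I c V ->
         forall t, I t -> T (c t) (covariant_derivative Gamma c V t)) &
      (forall I c V W, open I -> smooth_curve_on I c ->
         tangent_field_on I c V -> tangent_field_on I c W ->
         forall t, I t ->
           is_derive t 1 (fun s => g (c s) (V s) (W s))
             (g (c t) (covariant_derivative Gamma c V t) (W t) +
              g (c t) (V t) (covariant_derivative Gamma c W t)))].

Definition is_geodesic_on I c :=
  smooth_curve_on I c /\
  exists2 Gamma, is_levi_civita Gamma &
    forall t, I t -> covariant_derivative Gamma c (derive1 c) t = 0.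

Definition is_geodesic_from I (x v : E) c :=
  [/\ open I, is_interval I & I 0] /\
  [/\ is_geodesic_on I c, c 0 = x & derive1 c 0 = v].

End EmbeddedRiemannian.

Section Symplectic.
Variable R : realType.

Definition Jmx (m : nat) : 'M[R]_(m + m) := block_mx 0 1%:M (- 1%:M) 0.

Definition sympl_inv (a b : nat) (A : 'M[R]_(a + a, b + b)) :
    'M[R]_(b + b, a + a) :=
  (Jmx b)^T *m A^T *m Jmx a.

Definition Sp (n : nat) : set 'M[R]_(n + n) :=
  [set M | sympl_inv M *m M = 1%:M].

Definition sp_lie (n : nat) : set 'M[R]_(n + n) :=
  [set Omega | sympl_inv Omega = - Omega].

Definition Sp_tangent (n : nat) (M : 'M[R]_(n + n)) : set 'M[R]_(n + n) :=
  [set X | sp_lie (sympl_inv M *m X)].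

Definition Sp_metric (n : nat) (M X1 X2 : 'M[R]_(n + n)) : R :=
  2^-1 * \tr ((X1 *m sympl_inv M)^T *m (X2 *m sympl_inv M)).

Definition Sp_Exp (n : nat) (M X : 'M[R]_(n + n)) : 'M[R]_(n + n) :=
  let Y := X *m sympl_inv M in expmx (Y - Y^T) *m expmx Y^T *m M.

Definition SpSt (n k : nat) : set 'M[R]_(n + n, k + k) :=
  [set U | sympl_inv U *m U = 1%:M].

Definition SpSt_tangent (n k : nat) (U : 'M[R]_(n + n, k + k)) :
    set 'M[R]_(n + n, k + k) :=
  [set Delta | sp_lie (sympl_inv U *m Delta)].

Definition Emx (n k : nat) : 'M[R]_(n + n, k + k) :=
  block_mx (pid_mx k) 0 0 (pid_mx k).

Definition Sp_pi (n k : nat) (M : 'M[R]_(n + n)) : 'M[R]_(n + n, k + k) :=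
  M *m Emx n k.

(* X in T_M Sp(2n) is mapped to Delta by the differential of the linear map   *)
(* Sp_pi and is orthogonal to the kernel of that differential.                *)
Definition is_horizontal_lift (n k : nat) (M : 'M[R]_(n + n))
    (Delta : 'M[R]_(n + n, k + k)) (X : 'M[R]_(n + n)) :=
  [/\ Sp_tangent M X, Sp_pi k X = Delta &
      forall Y, Sp_tangent M Y -> Sp_pi k Y = 0 -> Sp_metric M X Y = 0].

Definition SpSt_metric (n k : nat) (U Delta1 Delta2 : 'M[R]_(n + n, k + k)) :
    R :=
  let G := invmx (U^T *m U) in
  \tr (Delta1^T *m
       (1%:M - 2^-1 *: ((Jmx n)^T *m U *m G *m U^T *m Jmx n)) *m
       Delta2 *m G).

Definition Omega_bar (n k : nat) (U Delta : 'M[R]_(n + n, k + k)) :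
    'M[R]_(n + n) :=
  let G := invmx (U^T *m U) in
  Delta *m G *m U^T +
  Jmx n *m U *m G *m Delta^T *m
    (1%:M - (Jmx n)^T *m U *m G *m U^T *m Jmx n) *m Jmx n.

End Symplectic.

(* Main.v *)
From HB Require Import structures.
Require Import Defs.
From mathcomp Require Import all_boot all_order perm all_algebra.
From mathcomp Require Import all_classical all_reals all_analysis.
From mathcomp Require Import ring lra.

(** Primes denote derivatives of curves.  Let [W = Omega_bar x X] be the
    horizontal matrix of a tangent vector [X] at [x]: the only matrix of the
    symplectic Lie algebra sp that maps [x] to [X] and is orthogonal, for the
    trace inner product, to every [B] in sp that kills [x]
    ([Omega_bar_unique]).  The metric of the Stiefel manifold is the quotient
    metric, in the form
      g x X (B x) = tr (W^T B) / 2   for every B in sp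
    ([SpSt_metric_Omega_bar]).  This gives the horizontal lift on the group,
    and reduces the geodesic equation to an ordinary differential equation for
    the curve of matrices [A = Omega_bar c c'], since the vectors [B x] fill
    the tangent space.

    That equation is the Euler-Arnold equation [A' = A A^T - A^T A].  It comes
    from metric compatibility and torsion-freeness alone, whatever Levi-Civita
    connection is used.  Let [x = c t].  The derivative at [t] of
    [g c c' (B c)] contains the term [g x (A x) (nabla (B c))].  On the orbit
    [s |-> exp(s B) x], the field [A y] has squared norm
    [g y (A y) (A y) <= tr (A^T A) / 2], with equality at [y = x], where [A] is
    horizontal; so the derivative of this norm vanishes at [s = 0]
    ([levi_civita_horizontal]).  By symmetry of the connection, only the
    bracket [(B A - A B) x] survives in [nabla (B c)], and one gets
      tr (A^T B)' = 2 g x (nabla c') (B x) + tr ((A A^T - A^T A)^T B)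
    ([levi_civita_momentum]).  The curve is therefore a geodesic exactly when
    [A] solves the Euler-Arnold equation.

    The equation integrates explicitly.  Its right-hand side is symmetric, so
    [S = A - A^T] is constant, the equation becomes the linear one
    [A' = S A - A S], and [A t = exp(t S) W exp(-t S)].  Then [c' = A c] becomes
    autonomous in the rotating frame [exp(-t S) c] and has the solution
    [exp(t S) exp(t W^T) U] ([arnold_flow], [arnold_trajectory]): uniqueness
    comes from the constancy of functions with zero derivative.  Conversely,
    along this product of exponentials, the matrix [exp(t S) W exp(-t S)] stays
    horizontal, because conjugation by [exp(t S) exp(t W^T)] preserves sp and
    [W^T] commutes with [exp(t W^T)] ([trajectory_Omega_bar]).

    A Levi-Civita connection has to be exhibited as well.  It is given by the
    Koszul formula; the linear form in that formula is represented by an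
    explicit tangent vector, built from the orthogonal projection of a gradient
    onto sp ([tangent_rieszP], [christoffel_levi_civita]). *)

Set Implicit Arguments.
Unset Strict Implicit.
Unset Printing Implicit Defensive.

Import Order.TTheory GRing.Theory Num.Theory.
Import numFieldNormedType.Exports.

Local Open Scope classical_set_scope.
Local Open Scope ring_scope.

(** * Derivatives of matrix-valued curves *)

Section MatrixCalculus.
Variable R : realType.
Implicit Types (t : R) (I : set R).

Lemma is_derive_mxP m n (A : R -> 'M[R]_(m, n)) A' t :
  is_derive t 1 A A' <-> forall i j, is_derive t 1 (fun s => A s i j) (A' i j).
Proof.
split=> [[dA <-] i j|dA].
  by rewrite derive_mx// mxE; apply: derivableP; exact: (derivable_mxP A t 1).1.
have dA' : derivable A t 1.
  by apply/(derivable_mxP A t 1) => i j; case: (dA i j).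
apply: DeriveDef => //; rewrite derive_mx//; apply/matrixP => i j.
by rewrite mxE; case: (dA i j).
Qed.

Lemma is_derive1E (V : normedModType R) (f : R -> V) f' t :
  is_derive t 1 f f' -> derive1 f t = f'.
Proof. by move=> [_ <-]; rewrite derive1E. Qed.

Lemma is_derive_mulmx m n p (A : R -> 'M[R]_(m, n)) (B : R -> 'M[R]_(n, p))
    A' B' t :
  is_derive t 1 A A' -> is_derive t 1 B B' ->
  is_derive t 1 (fun s => A s *m B s) (A' *m B t + A t *m B').
Proof.
move=> /is_derive_mxP dA /is_derive_mxP dB; apply/is_derive_mxP => i j.
have -> : (fun s => (A s *m B s) i j) =
    \sum_(k < n) (fun s => A s i k * B s k j).
  by apply/funext => s; rewrite mxE fct_sumE.
rewrite !mxE -big_split/=.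
apply: is_derive_sum => k; have dAk := dA i k; have dBk := dB k j.
apply: is_derive_eq; rewrite addrC; congr (_ + _); rewrite /GRing.scale/=.
by rewrite mulrC.
Qed.

(** A linear map of matrices is the finite combination of the entries whose
    coefficients are its values on the canonical basis. *)
Lemma is_derive_linear m n p q (f : {linear 'M[R]_(m, n) -> 'M[R]_(p, q)})
    (A : R -> 'M[R]_(m, n)) A' t :
  is_derive t 1 A A' -> is_derive t 1 (fun s => f (A s)) (f A').
Proof.
move=> /is_derive_mxP dA; apply/is_derive_mxP => i j.
have fE (C : 'M[R]_(m, n)) :
    f C i j = \sum_(k : 'I_m * 'I_n) f (delta_mx k.1 k.2) i j * C k.1 k.2.
  rewrite {1}[C]matrix_sum_delta pair_big/= linear_sum summxE.
  by apply: eq_bigr => k _; rewrite linearZ mxE mulrC.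
rewrite fE.
have -> : (fun s => f (A s) i j) =
   \sum_(k : 'I_m * 'I_n) (fun s => f (delta_mx k.1 k.2) i j *: A s k.1 k.2).
  by apply/funext => s; rewrite fct_sumE fE.
rewrite (reindex_onto enum_val enum_rank)/=; last first.
  by move=> *; rewrite enum_rankK.
rewrite [X in is_derive _ _ _ X](reindex_onto enum_val enum_rank)/=; last first.
  by move=> *; rewrite enum_rankK.
under eq_bigl do rewrite enum_valK eqxx.
under [X in is_derive _ _ _ X]eq_bigl do rewrite enum_valK eqxx.
apply: is_derive_sum => k; exact: is_deriveZ.
Qed.

Lemma is_derive_mxtrace n (A : R -> 'M[R]_n) A' t :
  is_derive t 1 A A' -> is_derive t 1 (fun s => \tr (A s)) (\tr A').
Proof.
move=> /is_derive_mxP dA.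
have -> : (fun s => \tr (A s)) = \sum_(i < n) (fun s => A s i i).
  by apply/funext => s; rewrite fct_sumE.
by apply: is_derive_sum => i; exact: dA.
Qed.

Lemma is_derive_mxtrace_tr m p (A : R -> 'M[R]_(m, p)) A'
    (B : 'M[R]_(m, p)) (t : R) :
  is_derive t 1 A A' ->
  is_derive t 1 (fun s => \tr ((A s)^T *m B)) (\tr (A'^T *m B)).
Proof.
move=> dA; apply: is_derive_mxtrace.
have := is_derive_mulmx (is_derive_linear (@trmx R m p) dA)
  (is_derive_cst B t 1).
by rewrite mulmx0 addr0.
Qed.

Lemma derivable_det n (A : R -> 'M[R]_n) t :
  derivable A t 1 -> derivable (fun s => \det (A s)) t 1.
Proof.
move=> /(derivable_mxP A t 1) dA.
have -> : (fun s => \det (A s)) = \sum_(u : 'S_n)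
    ((-1) ^+ u *: \prod_i (fun s => A s i (u i))).
  apply/funext => s; rewrite fct_sumE; apply: eq_bigr => u _.
  by rewrite /= fct_prodE.
elim/big_ind : _ => [|f g|u _]; first exact: derivable_cst.
  exact: derivableD.
apply: derivableZ; elim/big_ind : _ => [|f g|i _]; first exact: derivable_cst.
  exact: derivableM.
exact: dA.
Qed.

(** Cramer's rule gives differentiability of the inverse; its derivative then
    follows from differentiating [invmx (A s) *m A s = 1%:M] near [t]. *)
Lemma is_derive_invmx n (A : R -> 'M[R]_n) A' t :
  A t \in unitmx -> is_derive t 1 A A' ->
  is_derive t 1 (fun s => invmx (A s)) (- (invmx (A t) *m A' *m invmx (A t))).
Proof.
move=> At dA; have dA1 : derivable A t 1 by case: dA.
have detA := derivable_det dA1.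
have detA0 : \det (A t) != 0 by rewrite -unitfE.
have nunit : \near t, A t \in unitmx.
  have : \forall s \near t, \det (A s) != 0.
    apply: (@cvgr_neq0 _ _ _ (nbhs t) _ (fun s => \det (A s)) _ _ detA0).
    by move/derivable1_diffP/differentiable_continuous: detA.
  by apply: filterS => s; rewrite unitmxE unitfE.
have dinv : derivable (fun s => invmx (A s)) t 1.
  apply: (@near_eq_derivable _ _ _ (fun s => (\det (A s))^-1 *: \adj (A s))).
    by apply: filterS nunit => s As; rewrite /invmx As.
  apply/(derivable_mxP (fun s => (\det (A s))^-1 *: \adj (A s)) t 1) => i j.
  have -> : (fun s => ((\det (A s))^-1 *: \adj (A s)) i j) =
      (fun s => (\det (A s))^-1) *
      ((-1) ^+ (j + i) *: (fun s => \det (row' j (col' i (A s))))).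
    by apply/funext => s; rewrite !mxE.
  apply: derivableM; first exact: derivableV.
  apply/derivableZ/derivable_det.
  apply/(derivable_mxP (fun s => row' j (col' i (A s))) t 1) => k l.
  have -> : (fun s => (row' j (col' i (A s))) k l) =
    (fun s => A s (lift j k) (lift i l)) by apply/funext => s; rewrite !mxE.
  exact: ((derivable_mxP A t 1).1 dA1).
have := derivableP dinv; set G' := 'D_1 _ t => dG.
have dAG := is_derive_mulmx dG dA.
have d1 : is_derive t 1 (fun s => invmx (A s) *m A s) 0.
  apply: (@near_eq_is_derive _ _ _ (cst 1%:M)).
  by apply: filterS nunit => s As; rewrite mulVmx.
move/is_derive1E: dAG; rewrite (is_derive1E d1) => /esym/eqP.
rewrite addr_eq0 => /eqP /(congr1 (mulmx^~ (invmx (A t)))).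
by rewrite mulmxK// mulNmx => <-.
Qed.

Lemma is_derive0_cst_mx m n (I : set R) (A : R -> 'M[R]_(m, n)) :
  is_interval I -> (forall t, I t -> is_derive t 1 A 0) ->
  forall s t, I s -> I t -> A s = A t.
Proof.
move=> itvI dA.
suff H s t : s <= t -> I s -> I t -> A s = A t.
  by move=> s t Is It; have [st|/ltW ts] := leP s t; [|apply/esym]; apply: H.
move=> st Is It; apply/matrixP => i j.
have dAij u : I u -> is_derive u 1 (fun s => A s i j) 0.
  by move=> Iu; have /is_derive_mxP/(_ i j) := dA _ Iu; rewrite mxE.
have Iu u : u \in `[s, t]%R -> I u.
  by rewrite in_itv/= => /andP[su ut]; apply: (itvI s t) => //; rewrite su ut.
have [u||u uI] := @MVT_segment _ (fun s => A s i j) (fun=> 0) s t st.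
- by move=> ust; apply/dAij/Iu; exact: subset_itv_oo_cc ust.
- apply: derivable_within_continuous => u ust.
  by case: (dAij u (Iu _ ust)).
- by rewrite mul0r => /eqP; rewrite subr_eq0 => /eqP.
Qed.

Lemma smooth_on_is_derive p q (I : set R) (c : R -> 'M[R]_(p, q)) t :
  smooth_on I c -> I t -> is_derive t 1 c (derive1 c t).
Proof.
by move=> cI It; rewrite derive1E; apply: derivableP; exact: (cI 0 t It).
Qed.

Lemma smooth_on_derive1 p q (I : set R) (c : R -> 'M[R]_(p, q)) :
  smooth_on I c -> smooth_on I (derive1 c).
Proof. by move=> cI m t It; rewrite -derive1Sn; exact: (cI m.+1). Qed.

(** The iterated derivatives are only known to agree on [I], and differentiating
    needs agreement near each point: this is where [open I] enters. *)
Lemma smooth_on_mulmx p q r (I : set R) (B : 'M[R]_(r, p))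
    (c : R -> 'M[R]_(p, q)) :
  open I -> smooth_on I c -> smooth_on I (fun t => B *m c t).
Proof.
move=> oI cI.
have dBc m t : I t -> derive1n m (fun t => B *m c t) t = B *m derive1n m c t.
  elim: m t => [//|m IH] t It; rewrite !derive1nS derive1E.
  have nI : \near t, B *m derive1n m c t = derive1n m (fun t => B *m c t) t.
    by apply: filterS (open_nbhs_nbhs (conj oI It)) => s Is; rewrite IH.
  rewrite -(near_eq_derive _ nI) -derive1E.
  apply: is_derive1E; apply: (is_derive_linear (mulmx B)).
  by rewrite derive1E; apply: derivableP; exact: cI.
move=> m t It.
apply: (@near_eq_derivable _ _ _ (fun t => B *m derive1n m c t)).
  by apply: filterS (open_nbhs_nbhs (conj oI It)) => s Is; rewrite dBc.
have /derivableP dc := cI m t It.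
by case: (is_derive_linear (mulmx B) dc).
Qed.

End MatrixCalculus.

(** * The matrix exponential *)

Section Expmx.
Variable R : realType.
Implicit Types (t : R).

Lemma cvg_mxP m n (u : nat -> 'M[R]_(m, n)) (L : 'M[R]_(m, n)) :
  (u @ \oo --> L) <-> forall i j, (fun k => u k i j) @ \oo --> L i j.
Proof.
split=> [uL i j|uL].
  exact: (@cvg_comp _ _ _ u (fun M : 'M[R]_(m, n) => M i j) _ (nbhs L) _ uL
    (@coord_continuous R m n i j L)).
apply/cvgrPdist_le => /= e e0; near=> k.
rewrite /Num.Def.normr/= mx_normrE (bigmax_le _ (ltW e0))//= => i _.
rewrite !mxE/=; move: i; near: k; apply: filter_forall => /= i.
by have /cvgrPdist_le := uL i.1 i.2; apply.
Unshelve. all: by end_near. Qed.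

Definition mxnorm1 m n (A : 'M[R]_(m, n)) : R := \sum_i \sum_j `|A i j|.

Lemma le_mxnorm1 m n (A : 'M[R]_(m, n)) i j : `|A i j| <= mxnorm1 A.
Proof.
rewrite /mxnorm1 (bigD1 i)//= (bigD1 j)//= -!addrA lerDl addr_ge0// ?sumr_ge0//.
by move=> k _; rewrite sumr_ge0.
Qed.

Lemma mxnorm1_ge0 m n (A : 'M[R]_(m, n)) : 0 <= mxnorm1 A.
Proof. by apply: sumr_ge0 => i _; apply: sumr_ge0. Qed.

Lemma norm_expmx_coeff n p (A : 'M[R]_n) (N : 'M[R]_(n, p)) m i j :
  `|(A ^+ m *m N) i j| <= mxnorm1 A ^+ m * mxnorm1 N.
Proof.
elim: m i => [|m IH] i; first by rewrite expr0 mul1mx expr0 mul1r le_mxnorm1.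
rewrite exprS -mulmxA mxE (le_trans (ler_norm_sum _ _ _))//.
rewrite exprS -mulrA.
apply: (@le_trans _ _ (\sum_k `|A i k| * (mxnorm1 A ^+ m * mxnorm1 N))).
  by apply: ler_sum => k _; rewrite normrM ler_wpM2l// IH.
rewrite -mulr_suml ler_wpM2r//.
  by rewrite mulr_ge0// ?mxnorm1_ge0// exprn_ge0// mxnorm1_ge0.
rewrite /mxnorm1 [leRHS](bigD1 i)//= lerDl sumr_ge0// => k _.
by rewrite sumr_ge0.
Qed.

(** The entry [(i, j)] of [expmx (t *: A) *m N] is a power series in [t].  The
    extra factor [N] makes this family of series stable under termwise
    differentiation, which replaces [N] by [A *m N]. *)
Definition expmx_coeff n p (A : 'M[R]_n) (N : 'M[R]_(n, p)) i j : R^nat :=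
  fun m => (m`!%:R)^-1 * (A ^+ m *m N) i j.

Lemma is_cvg_pseries_expmx n p (A : 'M[R]_n) (N : 'M[R]_(n, p)) i j t :
  cvgn (pseries (expmx_coeff A N i j) t).
Proof.
apply: normed_cvg.
apply: (@series_le_cvg _ _ (mxnorm1 N *: exp_coeff (mxnorm1 A * `|t|))) => //.
- by move=> m; exact: normr_ge0.
- move=> m; rewrite -[leRHS]/(mxnorm1 N * exp_coeff _ _).
  rewrite mulr_ge0 ?mxnorm1_ge0// exp_coeff_ge0// mulr_ge0//.
  exact: mxnorm1_ge0.
- move=> m; rewrite -[leRHS]/(mxnorm1 N * exp_coeff _ _).
  rewrite -[leLHS]/(`|expmx_coeff A N i j m * t ^+ m|) /expmx_coeff.
  rewrite exp_coeffE !normrM normrX exprMn.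
  rewrite ger0_norm ?invr_ge0//.
  rewrite [leRHS](_ : _ =
    (m`!%:R)^-1 * (mxnorm1 A ^+ m * mxnorm1 N) * `|t| ^+ m).
    rewrite ler_wpM2r// ?exprn_ge0// ler_wpM2l// ?invr_ge0//.
    exact: norm_expmx_coeff.
  by rewrite mulrC -!mulrA; congr (_ * (_ * _)); rewrite mulrC.
- exact/is_cvg_seriesZ/is_cvg_series_exp_coeff.
Qed.

Lemma pseries_diffs_expmx n p (A : 'M[R]_n) (N : 'M[R]_(n, p)) i j :
  pseries_diffs (expmx_coeff A N i j) = expmx_coeff A (A *m N) i j.
Proof.
apply/funext => m; rewrite /pseries_diffs /expmx_coeff mulmxA.
rewrite (_ : A ^+ m *m A = A ^+ m.+1) ?exprSr//.
by rewrite factS natrM invfM mulrA mulVKf.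
Qed.

Lemma expmx_mulE n p (A : 'M[R]_n) (N : 'M[R]_(n, p)) t i j :
  (expmx (t *: A) *m N) i j = limn (pseries (expmx_coeff A N i j) t).
Proof.
have exprZ m : (t *: A) ^+ m = t ^+ m *: A ^+ m.
  elim: m => [|m IH]; first by rewrite scale1r.
  by rewrite !exprS IH -[LHS]/(_ *m _) -scalemxAl -scalemxAr scalerA.
have cvgE : series (fun m => (m`!%:R)^-1 *: ((t *: A) ^+ m)) @ \oo
    --> expmx (t *: A).
  have entry i' j' N' :
      (series (fun m => (m`!%:R)^-1 *: ((t *: A) ^+ m)) N') i' j' =
      pseries (expmx_coeff A 1%:M i' j') t N'.
    rewrite /series/= summxE; apply: eq_bigr => m _.
    rewrite /= /expmx_coeff mulmx1 exprZ !mxE -mulrA.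
    by congr (_ * _); rewrite mulrC.
  apply: (_ : cvgn (series _)).
  apply/cvg_ex.
  exists (\matrix_(i', j') limn (pseries (expmx_coeff A 1%:M i' j') t)).
  apply/cvg_mxP => i' j'; rewrite mxE; under eq_fun do rewrite entry.
  exact: is_cvg_pseries_expmx.
apply/esym/cvg_lim => //.
have {}cvgE k :
    (fun m => (series (fun m => (m`!%:R)^-1 *: ((t *: A) ^+ m)) m) i k) @ \oo
    --> expmx (t *: A) i k.
  by move/cvg_mxP : cvgE; apply.
have -> : pseries (expmx_coeff A N i j) t = (fun m => \sum_k
    (series (fun m => (m`!%:R)^-1 *: ((t *: A) ^+ m)) m) i k * N k j).
  apply/funext => M; rewrite /pseries/series/=.
  transitivity (((\sum_(0 <= m < M) (m`!%:R)^-1 *: (t *: A) ^+ m) *m N) i j).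
    rewrite mulmx_suml summxE; apply: eq_bigr => m _.
    by rewrite exprZ scalerA -scalemxAl [RHS]mxE /expmx_coeff /= mulrAC.
  by rewrite mxE.
rewrite mxE; apply: cvg_big => //; last first.
  by move=> k _; apply: cvgMl.
exact: add_continuous.
Qed.

Lemma expmxE n (A : 'M[R]_n) t i j :
  expmx (t *: A) i j = limn (pseries (expmx_coeff A 1%:M i j) t).
Proof. by rewrite -expmx_mulE mulmx1. Qed.

Lemma expmx_trmx n (A : 'M[R]_n) : expmx A^T = (expmx A)^T.
Proof.
apply/matrixP => i j; rewrite mxE -[A]scale1r linearZ/= !expmxE.
congr (limn (pseries _ _)); apply/funext => m; rewrite /expmx_coeff !mulmx1.
have -> : A^T ^+ m = (A ^+ m)^T.
  elim: m => [|m IH]; first by rewrite !expr0 trmx1.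
  by rewrite exprS exprSr IH -[LHS]/(_ *m _) -trmx_mul.
by rewrite mxE.
Qed.

Lemma expmx0 n : expmx (0 : 'M[R]_n) = 1%:M.
Proof.
apply/matrixP => i j; rewrite -[0](scale0r 0) expmxE.
apply/cvg_lim => //; rewrite -cvg_shiftS/=.
rewrite (_ : (fun _ => _) = cst (1%:M i j)); first exact: cvg_cst.
apply/funext => m; rewrite /pseries/series/= big_nat_recl// big1 ?addr0.
  by rewrite /expmx_coeff mulmx1 !expr0 mulr1 fact0 invr1 mul1r.
by move=> k _; rewrite exprS mul0r mulr0.
Qed.

Lemma is_derive_expmxr n (A : 'M[R]_n) t :
  is_derive t 1 (fun s => expmx (s *: A)) (expmx (t *: A) *m A).
Proof.
apply/is_derive_mxP => i j.
under eq_fun do rewrite expmxE.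
have -> : (expmx (t *: A) *m A) i j =
    limn (pseries (pseries_diffs (expmx_coeff A 1%:M i j)) t).
  by rewrite expmx_mulE pseries_diffs_expmx mulmx1.
apply: (@pseries_snd_diffs _ _ (`|t| + 1)); rewrite ?pseries_diffs_expmx.
- exact: is_cvg_pseries_expmx.
- exact: is_cvg_pseries_expmx.
- exact: is_cvg_pseries_expmx.
- by rewrite [ltRHS]ger0_norm// ltrDl.
Qed.

(** Transposing the curve of [A^T] moves the factor to the other side; comparing
    with [is_derive_expmxr], this encodes that [A] commutes with its
    exponential. *)
Lemma is_derive_expmxl n (A : 'M[R]_n) t :
  is_derive t 1 (fun s => expmx (s *: A)) (A *m expmx (t *: A)).
Proof.
have := is_derive_linear (@trmx R n n) (is_derive_expmxr A^T t).
rewrite /= trmx_mul -expmx_trmx linearZ/= trmxK.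
by under eq_fun do rewrite -expmx_trmx linearZ/= trmxK.
Qed.

(** The middle factor makes this family of curves stable under differentiation:
    the derivative has the same shape, with [S *m N + N *m T] in the middle.
    Smoothness of all the curves used below follows. *)
Definition expmx_curve n p (S T N : 'M[R]_n) (x : 'M[R]_(n, p)) t :=
  expmx (t *: S) *m N *m expmx (t *: T) *m x.

Lemma is_derive_expmx_curve n p (S T N : 'M[R]_n) (x : 'M[R]_(n, p)) t :
  is_derive t 1 (expmx_curve S T N x) (expmx_curve S T (S *m N + N *m T) x t).
Proof.
have d1 := is_derive_mulmx (is_derive_expmxr S t) (is_derive_cst N t 1).
have d2 := is_derive_mulmx d1 (is_derive_expmxl T t).
have := is_derive_mulmx d2 (is_derive_cst x t 1).
rewrite !mulmx0 !addr0 => d; apply: (is_derive_eq d).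
by rewrite /expmx_curve /cst !mulmxDr !mulmxDl !mulmxA.
Qed.

Lemma smooth_expmx_curve n p (S T N : 'M[R]_n) (x : 'M[R]_(n, p)) I :
  smooth_on I (expmx_curve S T N x).
Proof.
move=> m t _; elim: m N => [|m IH] N.
  by rewrite derive1n0; case: (is_derive_expmx_curve S T N x t).
rewrite derive1Sn (_ : derive1 _ = expmx_curve S T (S *m N + N *m T) x) ?IH//.
by apply/funext => s; rewrite (is_derive1E (is_derive_expmx_curve _ _ _ _ _)).
Qed.

Lemma expmx_curve0E m p (N : 'M[R]_m) (x : 'M[R]_(m, p)) (C : 'M[R]_m) :
  expmx_curve 0 C N x = fun s => N *m (expmx (s *: C) *m x).
Proof.
by apply/funext => s; rewrite /expmx_curve scaler0 expmx0 mul1mx mulmxA.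
Qed.

(** The derivative of [t |-> exp(t Y) N exp(t X)] vanishes.  With [N = 1%:M]
    this inverts exponentials, with [N] the symplectic form it puts the
    exponential of a Hamiltonian matrix in the symplectic group, and with
    [Y = - X] it says that what commutes with [X] commutes with its
    exponential. *)
Lemma expmx_sandwich n (Y X N : 'M[R]_n) t :
  Y *m N + N *m X = 0 -> expmx (t *: Y) *m N *m expmx (t *: X) = N.
Proof.
move=> YNX.
have /(_ t 0 I I) : forall s t, setT s -> setT t ->
    expmx_curve Y X N 1%:M s = expmx_curve Y X N 1%:M t.
  apply: is_derive0_cst_mx => [? ? ? ? ? //|s _].
  have := is_derive_expmx_curve Y X N 1%:M s.
  by rewrite YNX /expmx_curve mulmx0 !mul0mx.
by rewrite /expmx_curve !mulmx1 !scale0r !expmx0 mul1mx mulmx1.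
Qed.

Lemma expmxNK n (X : 'M[R]_n) t :
  expmx (t *: - X) *m expmx (t *: X) = 1%:M.
Proof.
by rewrite -[X in X *m _]mulmx1 expmx_sandwich// mulmx1 mul1mx addNr.
Qed.

Lemma expmxKN n (X : 'M[R]_n) t :
  expmx (t *: X) *m expmx (t *: - X) = 1%:M.
Proof. by rewrite -{1}[X]opprK expmxNK. Qed.

Lemma expmx_conjE m (S W : 'M[R]_m) :
  expmx_curve S (- S) W 1%:M =
  fun s : R => expmx (s *: S) *m W *m expmx (s *: - S).
Proof. by apply/funext => s; rewrite /expmx_curve mulmx1. Qed.

Lemma is_derive_expmx_conj m (S W : 'M[R]_m) (t : R) :
  is_derive t 1 (fun s => expmx (s *: S) *m W *m expmx (s *: - S))
    (expmx (t *: S) *m (S *m W - W *m S) *m expmx (t *: - S)).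
Proof.
have := is_derive_expmx_curve S (- S) W 1%:M t.
by rewrite !expmx_conjE mulmxN.
Qed.

End Expmx.

Local Opaque expmx.

(** * The trace inner product *)

Section Frobenius.
Variable R : realType.

Lemma mxtrace_mulTmx m n (A B : 'M[R]_(m, n)) :
  \tr (A^T *m B) = \sum_i \sum_j A j i * B j i.
Proof.
by apply: eq_bigr => i _; rewrite mxE; apply: eq_bigr => j _; rewrite mxE.
Qed.

Lemma mxtrace_mulTmx_sym m n (A B : 'M[R]_(m, n)) :
  \tr (A^T *m B) = \tr (B^T *m A).
Proof. by rewrite -mxtrace_tr trmx_mul trmxK. Qed.

Lemma mxtrace_mulTmx_ge0 m n (A : 'M[R]_(m, n)) : 0 <= \tr (A^T *m A).
Proof.
rewrite mxtrace_mulTmx; apply: sumr_ge0 => i _; apply: sumr_ge0 => j _.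
by rewrite -expr2 sqr_ge0.
Qed.

Lemma mxtrace_mulTmx_eq0 m n (A : 'M[R]_(m, n)) :
  \tr (A^T *m A) = 0 -> A = 0.
Proof.
rewrite mxtrace_mulTmx => A0; apply/matrixP => i j; rewrite mxE.
have sq_ge0 k l : 0 <= A k l * A k l by rewrite -expr2 sqr_ge0.
have col0 : \sum_k A k j * A k j = 0.
  by apply: (psumr_eq0P _ A0) => // l _; apply: sumr_ge0.
have := psumr_eq0P (fun k _ => sq_ge0 k j) col0 => /(_ i isT).
by move/eqP; rewrite mulf_eq0 orbb => /eqP.
Qed.

Lemma mxtrace_mulTmx_le m n (A B : 'M[R]_(m, n)) : \tr (A^T *m B) = 0 ->
  \tr (A^T *m A) <= \tr ((A + B)^T *m (A + B)).
Proof.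
move=> AB0; rewrite [(A + B)^T]linearD/= mulmxDr !mulmxDl !linearD/=.
rewrite (mxtrace_mulTmx_sym B A) AB0 addr0 add0r.
by rewrite -[leLHS]addr0 lerD// mxtrace_mulTmx_ge0.
Qed.

Lemma mxtrace_mulTmx_delta m n (A : 'M[R]_(m, n)) i j :
  \tr (A^T *m delta_mx i j) = A i j.
Proof.
rewrite mxtrace_mulTmx (bigD1 j)//= (bigD1 i)//= !mxE !eqxx mulr1.
rewrite !big1 ?addr0// => [l /negPf lj|l /negPf li].
  by rewrite big1// => l' _; rewrite mxE lj andbF mulr0.
by rewrite mxE li mulr0.
Qed.

(** The matrix of the values of [f] on the canonical basis is the gradient of
    [f]. *)
Lemma mxtrace_mulTmx_grad m n (f : {scalar 'M[R]_(m, n)}) Z :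
  \tr ((\matrix_(i, j) f (delta_mx i j))^T *m Z) = f Z.
Proof.
rewrite {2}[Z]matrix_sum_delta linear_sum mxtrace_mulTmx exchange_big/=.
apply: eq_bigr => i _; rewrite linear_sum; apply: eq_bigr => j _.
by rewrite linearZ mxE mulrC.
Qed.

(** For [Q] orthogonal of inverse [Q'], and [P] of inverse [P'] that commutes
    with [W^T], this transports orthogonality by conjugation with [Q *m P]. *)
Lemma mxtrace_conj_tr m (Q Q' P P' W B : 'M[R]_m) :
  Q^T = Q' -> Q'^T = Q -> P *m W^T *m P' = W^T ->
  \tr (W^T *m (P' *m (Q' *m B *m Q) *m P)) = 0 ->
  \tr ((Q *m W *m Q')^T *m B) = 0.
Proof.
move=> QT Q'T PWP <-.
have -> : \tr ((Q *m W *m Q')^T *m B) = \tr (W^T *m (Q' *m B *m Q)).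
  by rewrite !trmx_mul QT Q'T -!mulmxA [LHS]mxtrace_mulC !mulmxA.
by rewrite -{1}PWP -!mulmxA [LHS]mxtrace_mulC !mulmxA.
Qed.

Lemma mxtrace_comm_tr m (A B : 'M[R]_m) :
  \tr (A^T *m (B *m A - A *m B)) =
  \tr ((A *m A^T - A^T *m A)^T *m B).
Proof.
rewrite mulmxBr [(_ - _)^T]raddfB/= mulmxBl !raddfB/= !trmx_mul !trmxK.
by rewrite (mulmxA A^T) mxtrace_mulC !mulmxA.
Qed.

Lemma mulmx_conj_cancel m p (Q Q' W P : 'M[R]_m)
    (x : 'M[R]_(m, p)) :
  Q' *m Q = 1%:M -> Q *m W *m Q' *m (Q *m P *m x) = Q *m (W *m P) *m x.
Proof. by move=> Q'Q; rewrite -!mulmxA (mulmxA Q') Q'Q mul1mx. Qed.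

Lemma conj_comm_tr m (Q Q' W : 'M[R]_m) :
  Q^T = Q' -> Q'^T = Q -> Q' *m Q = 1%:M ->
  let A := Q *m W *m Q' in
  A *m A^T - A^T *m A = Q *m (W *m W^T - W^T *m W) *m Q'.
Proof.
move=> QT Q'T Q'Q A.
have -> : A^T = Q *m W^T *m Q' by rewrite /A !trmx_mul QT Q'T mulmxA.
by rewrite /A !mulmx_conj_cancel// mulmxBr mulmxBl.
Qed.

Lemma mulmx_antisym_comm m (W : 'M[R]_m) :
  (W - W^T) *m W - W *m (W - W^T) = W *m W^T - W^T *m W.
Proof.
by rewrite mulmxBl mulmxBr opprB addrC subrKA.
Qed.

End Frobenius.

(** * The Euler-Arnold equation *)

Section ArnoldODE.
Variables (R : realType) (m p : nat) (I : set R).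
Hypotheses (itvI : is_interval I) (I0 : I 0).

(** The right-hand side is symmetric, so [A - A^T] is constant and the equation
    is the linear equation [A' = S A - A S]. *)
Lemma arnold_flow (A : R -> 'M[R]_m) :
  (forall t, I t -> is_derive t 1 A (A t *m (A t)^T - (A t)^T *m A t)) ->
  let S := A 0 - (A 0)^T in
  forall t, I t -> A t = expmx (t *: S) *m A 0 *m expmx (t *: - S).
Proof.
move=> dA S.
have SE t : I t -> A t - (A t)^T = S.
  move=> It.
  apply: (@is_derive0_cst_mx _ _ _ I (fun t => A t - (A t)^T)) => // s Is.
  have dT := is_derive_linear (@trmx R m m) (dA s Is).
  have d := is_deriveB (dA s Is) dT; apply: (is_derive_eq d).
  by rewrite /= [(_ - _)^T]raddfB/= !trmx_mul !trmxK subrr.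
clearbody S; pose F t := expmx (t *: - S) *m A t *m expmx (t *: S).
have FE t : I t -> F t = A 0.
  move=> It; transitivity (F 0); last first.
    by rewrite /F !scale0r expmx0 mul1mx mulmx1.
  apply: (@is_derive0_cst_mx _ _ _ I F) => // s Is.
  have d := is_derive_mulmx
    (is_derive_mulmx (is_derive_expmxr (- S) s) (dA s Is))
    (is_derive_expmxl S s).
  apply: (is_derive_eq d).
  rewrite -mulmx_antisym_comm SE// mulmxBr !mulmxDl !mulmxN !mulNmx !mulmxA.
  by rewrite addrA addNr add0r addNr.
move=> t It; rewrite -(FE t It) /F !mulmxA expmxKN mul1mx -mulmxA expmxKN.
by rewrite mulmx1.
Qed.

(** In the frame [exp(- t S) c t] the equation is autonomous, with matrix
    [W - S = W^T]. *)
Lemma arnold_trajectory (W : 'M[R]_m) (c : R -> 'M[R]_(m, p)) :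
  let S := W - W^T in
  (forall t, I t -> is_derive t 1 c
     (expmx (t *: S) *m W *m expmx (t *: - S) *m c t)) ->
  forall t, I t -> c t = expmx_curve S W^T 1%:M (c 0) t.
Proof.
move=> S dc.
pose d t := expmx (t *: - W^T) *m expmx (t *: - S) *m c t.
have dE t : I t -> d t = c 0.
  move=> It; transitivity (d 0); last first.
    by rewrite /d !scale0r !expmx0 !mul1mx.
  apply: (@is_derive0_cst_mx _ _ _ I d) => // s Is.
  have h := is_derive_mulmx (is_derive_mulmx (is_derive_expmxr (- W^T) s)
     (is_derive_expmxl (- S) s)) (dc s Is).
  apply: (is_derive_eq h).
  set E := expmx (s *: - S); set E' := expmx (s *: - W^T).
  set F := expmx (s *: S).
  have EE : E *m F = 1%:M by exact: expmxNK.
  clearbody E E' F.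
  have -> : E' *m E *m (F *m W *m E *m c s) = E' *m W *m E *m c s.
    by rewrite -!mulmxA (mulmxA E) EE mul1mx.
  rewrite !mulmxA -!mulmxDl -!mulmxDr.
  by rewrite /S opprB addKr addNr mulmx0 !mul0mx.
move=> t It; rewrite -(dE t It) /expmx_curve /d mulmx1.
rewrite -mulmxA !mulmxA.
by rewrite -(mulmxA _ (expmx (t *: W^T))) expmxKN mulmx1 expmxKN mul1mx.
Qed.

End ArnoldODE.

(** * Symplectic matrices *)

Section Symplectic.
Variable R : realType.
Local Notation J := (Jmx R _).

Lemma Jmx_tr m : (Jmx R m)^T = - Jmx R m.
Proof.
by rewrite /Jmx tr_block_mx !trmx0 linearN/= trmx1 opp_block_mx opprK !oppr0.
Qed.

Lemma Jmx_sqr m : Jmx R m *m Jmx R m = - 1%:M.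
Proof.
rewrite /Jmx mulmx_block !mul0mx !mulmx0 !mulmx1 !mul1mx !add0r !addr0.
by rewrite [in RHS]scalar_mx_block opp_block_mx !oppr0.
Qed.

Lemma mulmxJJ m p (A : 'M[R]_(p, m + m)) : A *m Jmx R m *m Jmx R m = - A.
Proof. by rewrite -mulmxA Jmx_sqr mulmxN mulmx1. Qed.

Lemma mulJJmx m p (A : 'M[R]_(m + m, p)) : Jmx R m *m (Jmx R m *m A) = - A.
Proof. by rewrite mulmxA Jmx_sqr mulNmx mul1mx. Qed.

Lemma mulmxJ_inj m p : injective (fun A : 'M[R]_(p, m + m) => A *m Jmx R m).
Proof.
by move=> A B /(congr1 (mulmx^~ (Jmx R m))); rewrite !mulmxJJ => /oppr_inj.
Qed.

Lemma sympl_invE a b (A : 'M[R]_(a + a, b + b)) :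
  sympl_inv A = - (Jmx R b *m A^T *m Jmx R a).
Proof. by rewrite /sympl_inv Jmx_tr !mulNmx. Qed.

Lemma sympl_inv_is_linear a b : linear (@sympl_inv R a b).
Proof.
move=> x A B; rewrite /sympl_inv linearD/= linearZ/= mulmxDr mulmxDl.
by rewrite -scalemxAr -scalemxAl.
Qed.

HB.instance Definition _ a b := GRing.isLinear.Build R
  'M[R]_(a + a, b + b) 'M[R]_(b + b, a + a) _ (@sympl_inv R a b)
  (@sympl_inv_is_linear a b).

Lemma sympl_invM a b c (A : 'M[R]_(a + a, b + b)) (B : 'M[R]_(b + b, c + c)) :
  sympl_inv (A *m B) = sympl_inv B *m sympl_inv A.
Proof.
by rewrite !sympl_invE trmx_mul mulmxN mulNmx opprK !mulmxA mulmxJJ !mulNmx.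
Qed.

Lemma sympl_invK a b (A : 'M[R]_(a + a, b + b)) : sympl_inv (sympl_inv A) = A.
Proof.
rewrite !sympl_invE linearN/= !trmx_mul trmxK !Jmx_tr.
by rewrite !(mulmxN, mulNmx, opprK, mulmxA) mulmxJJ Jmx_sqr mulNmx mul1mx opprK.
Qed.

Lemma sympl_inv_tr a b (A : 'M[R]_(a + a, b + b)) :
  sympl_inv A^T = (sympl_inv A)^T.
Proof.
rewrite !sympl_invE linearN/= !trmx_mul trmxK !Jmx_tr.
by rewrite !(mulmxN, mulNmx, opprK, mulmxA).
Qed.

Lemma mxtrace_sympl_inv a (A : 'M[R]_(a + a)) : \tr (sympl_inv A) = \tr A.
Proof.
rewrite sympl_invE linearN/= mxtrace_mulC mulmxA Jmx_sqr mulNmx mul1mx.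
by rewrite linearN/= opprK mxtrace_tr.
Qed.

Lemma sp_lieP n (B : 'M[R]_(n + n)) : sp_lie B <-> B^T = J *m B *m J.
Proof.
rewrite /sp_lie/= sympl_invE; split=> [/oppr_inj BE|->].
  by rewrite -[in RHS]BE !mulmxA mulmxJJ Jmx_sqr mulNmx mul1mx opprK.
by rewrite !mulmxA mulmxJJ Jmx_sqr mulNmx mul1mx opprK.
Qed.

Lemma sp_lie_mulJ n (B : 'M[R]_(n + n)) : sp_lie B -> B^T *m J = - (J *m B).
Proof. by move=> /sp_lieP ->; rewrite mulmxJJ. Qed.

Lemma sp_lieN n (A : 'M[R]_(n + n)) : sp_lie A -> sp_lie (- A).
Proof. by rewrite /sp_lie/= linearN/= => ->. Qed.

Lemma sp_lieB n (A B : 'M[R]_(n + n)) : sp_lie A -> sp_lie B -> sp_lie (A - B).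
Proof.
by rewrite /sp_lie/= => Asp Bsp; rewrite linearB/= Asp Bsp opprB opprK addrC.
Qed.

Lemma sp_lie_comm n (A B : 'M[R]_(n + n)) :
  sp_lie A -> sp_lie B -> sp_lie (A *m B - B *m A).
Proof.
rewrite /sp_lie/= => Asp Bsp; rewrite linearB/= !sympl_invM Asp Bsp.
by rewrite !mulNmx !mulmxN !opprK opprB.
Qed.

Lemma sp_lie_tr n (A : 'M[R]_(n + n)) : sp_lie A -> sp_lie A^T.
Proof. by rewrite /sp_lie/= sympl_inv_tr => ->; rewrite linearN. Qed.

Lemma sp_lie_antisym n (B : 'M[R]_(n + n)) : sp_lie (B - sympl_inv B).
Proof. by rewrite /sp_lie/= linearB/= sympl_invK opprB. Qed.

(** The symplectic inverse is an isometric involution, and sp is its eigenspace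
    for the eigenvalue [-1]: half of [B - sympl_inv B] is the orthogonal
    projection of [B] onto sp. *)
Lemma mxtrace_sp_antisym n (A B : 'M[R]_(n + n)) : sp_lie A ->
  \tr (A^T *m (B - sympl_inv B)) = 2 * \tr (A^T *m B).
Proof.
move=> Asp; rewrite mulmxBr linearB/= -[X in _ - X]mxtrace_sympl_inv.
rewrite sympl_invM sympl_invK sympl_inv_tr (Asp : sympl_inv A = _).
by rewrite linearN/= mulmxN linearN/= opprK mxtrace_mulC -mulr2n mulr_natl.
Qed.

Lemma sympl_inv_expmx n (B : 'M[R]_(n + n)) (t : R) : sp_lie B ->
  sympl_inv (expmx (t *: B)) = expmx (t *: - B).
Proof.
move=> Bsp; rewrite -[LHS]mulmx1 -(expmxKN B t) mulmxA.
rewrite [X in X *m _](_ : _ = 1%:M) ?mul1mx//.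
rewrite sympl_invE mulNmx -expmx_trmx linearZ/= -!mulmxA (mulmxA (expmx _)).
by rewrite expmx_sandwich ?Jmx_sqr ?opprK// (sp_lie_mulJ Bsp) addNr.
Qed.

Lemma sp_lie_conj n (A B : 'M[R]_(n + n)) (t : R) : sp_lie A -> sp_lie B ->
  sp_lie (expmx (t *: A) *m B *m expmx (t *: - A)).
Proof.
move=> Asp; rewrite /sp_lie/= => Bsp; rewrite !sympl_invM Bsp.
rewrite !sympl_inv_expmx ?opprK//; last exact: sp_lieN.
by rewrite mulNmx mulmxN mulmxA.
Qed.

Lemma SpStP n k (U : 'M[R]_(n + n, k + k)) : SpSt U <-> U^T *m J *m U = J.
Proof.
rewrite /SpSt/= sympl_invE; split=> [/(congr1 (mulmx J))|UJU].
  by rewrite mulNmx mulmxN -!mulmxA mulJJmx opprK mulmx1.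
by rewrite mulNmx -!mulmxA [U^T *m _]mulmxA UJU Jmx_sqr opprK.
Qed.

Lemma SpSt_tangentP n k (U D : 'M[R]_(n + n, k + k)) :
  SpSt_tangent U D <-> (U^T *m J *m D)^T = U^T *m J *m D.
Proof.
rewrite /SpSt_tangent/=; apply: (iff_trans (sp_lieP _)).
have -> : sympl_inv U *m D = - (J *m (U^T *m J *m D)).
  by rewrite sympl_invE mulNmx !mulmxA.
rewrite linearN/= trmx_mul Jmx_tr mulmxN opprK mulmxN mulJJmx opprK.
by split=> [/mulmxJ_inj|->].
Qed.

Lemma SpSt_expmx_mul n k (B : 'M[R]_(n + n)) (x : 'M[R]_(n + n, k + k))
    (t : R) :
  sp_lie B -> SpSt x -> SpSt (expmx (t *: B) *m x).
Proof.
move=> Bsp /SpStP xJx; apply/SpStP.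
set E := expmx _.
have EJE : E^T *m Jmx R n *m E = Jmx R n.
  rewrite -expmx_trmx linearZ/= expmx_sandwich//.
  by rewrite (sp_lie_mulJ Bsp) addNr.
transitivity (x^T *m (E^T *m Jmx R n *m E) *m x).
  by rewrite trmx_mul !mulmxA.
by rewrite EJE.
Qed.

End Symplectic.

(** * Horizontal matrices and the metric *)

Section HorizontalLift.
Variables (R : realType) (n k : nat).
Local Notation J := (Jmx R _).
Implicit Types (U D X Y Z : 'M[R]_(n + n, k + k)) (A B : 'M[R]_(n + n)).

Definition gram_inv U := invmx (U^T *m U).
Local Notation G := gram_inv.

(** If [v *m U^T *m U = 0] then [U *m v^T] has zero norm, and [U] has the left
    inverse [sympl_inv U]. *)
Lemma SpSt_gram_unit U : SpSt U -> U^T *m U \in unitmx.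
Proof.
move=> USt; rewrite -row_free_unit -kermx_eq0; apply/eqP.
apply/row_matrixP => i; rewrite row0; set v := row i _.
have vUU : v *m (U^T *m U) = 0 by apply/sub_kermxP; exact: row_sub.
have /mxtrace_mulTmx_eq0 Uv : \tr ((U *m v^T)^T *m (U *m v^T)) = 0.
  by rewrite trmx_mul trmxK -mulmxA (mulmxA U^T) mulmxA vUU mul0mx linear0.
apply: trmx_inj; rewrite trmx0 -[LHS]mul1mx.
by have <- : sympl_inv U *m U = 1%:M := USt; rewrite -mulmxA Uv mulmx0.
Qed.

Lemma gram_inv_tr U : (G U)^T = G U.
Proof. by rewrite /gram_inv trmx_inv trmx_mul trmxK. Qed.

Lemma gram_invK U : SpSt U -> G U *m U^T *m U = 1%:M.
Proof. by move=> USt; rewrite -mulmxA mulVmx// SpSt_gram_unit. Qed.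

Lemma mulmx_gram_invK m U (A : 'M[R]_(m, k + k)) :
  SpSt U -> A *m G U *m U^T *m U = A.
Proof. by move=> USt; rewrite -!mulmxA (mulmxA (G U)) gram_invK// mulmx1. Qed.

(** The first two terms are [C - sympl_inv C] for [C = D *m G U *m U^T]; the
    third one belongs to sp because [U^T *m J *m D] is symmetric, which is what
    tangency says ([SpSt_tangentP]). *)
Lemma Omega_barE U D : Omega_bar U D =
  D *m G U *m U^T + J *m U *m G U *m D^T *m J
  + J *m U *m G U *m (U^T *m J *m D)^T *m G U *m U^T.
Proof.
rewrite /Omega_bar -/(gram_inv U) -addrA; congr (_ + _).
rewrite mulmxBr mulmx1 mulmxBl; congr (_ + _).
by rewrite !mulmxA mulmxJJ opprK !trmx_mul !trmxK !mulmxA.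
Qed.

Lemma Omega_bar_sp U D : SpSt_tangent U D -> sp_lie (Omega_bar U D).
Proof.
move=> /SpSt_tangentP DT; apply/sp_lieP; rewrite Omega_barE DT.
move: (U^T *m J *m D) DT => s DT.
rewrite !raddfD/= !trmx_mul !trmxK !gram_inv_tr DT Jmx_tr.
rewrite !(mulmxDr, mulmxDl, mulmxN, mulNmx, opprK, mulmxA).
rewrite !(mulmxJJ, Jmx_sqr, mulmxN, mulNmx, mul1mx, opprK).
by rewrite [X in X - _]addrC.
Qed.

Lemma Omega_bar_mul U D : SpSt U -> Omega_bar U D *m U = D.
Proof.
move=> USt; rewrite Omega_barE !mulmxDl !mulmx_gram_invK//.
by rewrite !trmx_mul trmxK Jmx_tr !(mulmxN, mulNmx) !mulmxA addrK.
Qed.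

Lemma sp_lie_tangent U B : sp_lie B -> SpSt_tangent U (B *m U).
Proof.
move=> /sp_lieP BE; apply/SpSt_tangentP.
rewrite !trmx_mul trmxK BE Jmx_tr !(mulmxA, mulmxN, mulNmx).
by rewrite mulmxJJ !mulNmx opprK.
Qed.

Definition trform (P : 'M[R]_(n + n)) (Q : 'M[R]_(k + k)) Y Z : R :=
  \tr (Y^T *m P *m Z *m Q).

Lemma SpSt_metricE U : SpSt_metric U =
  trform (1%:M - 2^-1 *: (J^T *m U *m G U *m U^T *m J)) (G U).
Proof. by []. Qed.

(** The Stiefel metric is the quotient of the right-invariant metric: pairing
    [D] with the velocity [B *m U] amounts to pairing its horizontal matrix with
    [B].  Replacing [J *m B] by [- (B^T *m J)] turns the traces of the three
    terms of [Omega_barE] against [B] into traces against [B *m U]. *)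
Lemma SpSt_metric_Omega_bar U D B : sp_lie B ->
  SpSt_metric U D (B *m U) = 2^-1 * \tr ((Omega_bar U D)^T *m B).
Proof.
move=> /sp_lie_mulJ BJ.
have JB : J *m B = - (B^T *m J) by rewrite BJ opprK.
have trE : \tr (D^T *m (B *m U) *m G U) = \tr (D *m G U *m (B *m U)^T).
  rewrite -[LHS]mxtrace_tr !trmx_mul !trmxK gram_inv_tr.
  by rewrite !mulmxA mxtrace_mulC !mulmxA.
rewrite Omega_barE linearD/= mulmxDl linearD/= linearD/= mulmxDl linearD/=.
have -> : \tr ((D *m G U *m U^T)^T *m B) = \tr (D^T *m (B *m U) *m G U).
  rewrite !trmx_mul trmxK gram_inv_tr -!mulmxA [LHS]mxtrace_mulC -!mulmxA.
  by rewrite [LHS]mxtrace_mulC !mulmxA.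
have -> : \tr ((J *m U *m G U *m D^T *m J)^T *m B) =
    \tr (D^T *m (B *m U) *m G U).
  rewrite trE !trmx_mul trmxK gram_inv_tr !Jmx_tr.
  rewrite !mulmxA !(mulmxN, mulNmx) opprK.
  rewrite -(mulmxA _ J) JB mulmxN linearN/= !mulmxA mxtrace_mulC.
  by rewrite !mulmxA Jmx_sqr !mulNmx mul1mx linearN/= opprK.
have -> : \tr ((J *m U *m G U *m (U^T *m J *m D)^T *m G U *m U^T)^T *m B) =
    \tr (D^T *m (J *m U *m G U *m U^T *m J) *m (B *m U) *m G U).
  rewrite !(trmx_mul _ U^T) !trmxK (trmx_mul _ (G U)) (trmx_mul _ _^T) trmxK.
  rewrite !trmx_mul !gram_inv_tr Jmx_tr -!mulmxA !(mulmxN, mulNmx) JB.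
  rewrite !mulmxN opprK -[LHS]mxtrace_tr !trmx_mul !trmxK !gram_inv_tr Jmx_tr.
  transitivity (\tr ((J *m B *m U *m G U) *m (D^T *m J *m U *m G U *m U^T))).
    by rewrite !(mulmxN, mulNmx) opprK !mulmxA.
  by rewrite mxtrace_mulC !mulmxA.
rewrite SpSt_metricE /trform Jmx_tr !mulNmx scalerN opprK mulmxDr mulmx1.
rewrite !mulmxDl linearD/= -scalemxAr -!scalemxAl linearZ/=.
by field.
Qed.

Lemma trform_sym P Q Y Z :
  P^T = P -> Q^T = Q -> trform P Q Y Z = trform P Q Z Y.
Proof.
move=> PT QT; rewrite /trform -mxtrace_tr !trmx_mul trmxK PT QT.
by rewrite mxtrace_mulC !mulmxA.
Qed.

Lemma trform_is_scalar P Q Y : scalar (trform P Q Y).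
Proof.
move=> a Z Z'; rewrite /trform mulmxDr mulmxDl -scalemxAr -scalemxAl.
by rewrite linearD linearZ.
Qed.

HB.instance Definition _ P Q Y := GRing.isLinear.Build R
  'M[R]_(n + n, k + k) R *%R (trform P Q Y) (trform_is_scalar P Q Y).

Lemma SpSt_metric_sym U Y Z : SpSt_metric U Y Z = SpSt_metric U Z Y.
Proof.
rewrite SpSt_metricE trform_sym// ?gram_inv_tr// linearB/= trmx1 linearZ/=.
by rewrite !trmx_mul !trmxK gram_inv_tr Jmx_tr !(mulmxN, mulNmx, mulmxA).
Qed.

Lemma SpSt_metric_linear U X a Y Z :
  SpSt_metric U X (a *: Y + Z) = a * SpSt_metric U X Y + SpSt_metric U X Z.
Proof. by rewrite SpSt_metricE linearP. Qed.

Lemma SpSt_metric_linear_l U X a Y Z :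
  SpSt_metric U (a *: Y + Z) X = a * SpSt_metric U Y X + SpSt_metric U Z X.
Proof.
by rewrite SpSt_metric_sym SpSt_metric_linear !(SpSt_metric_sym _ X).
Qed.

Lemma SpSt_metricDl U X Y Z :
  SpSt_metric U (Y + Z) X = SpSt_metric U Y X + SpSt_metric U Z X.
Proof. by rewrite -[Y]scale1r SpSt_metric_linear_l mul1r scale1r. Qed.

Lemma SpSt_metricDr U X Y Z :
  SpSt_metric U X (Y + Z) = SpSt_metric U X Y + SpSt_metric U X Z.
Proof. by rewrite -[Y]scale1r SpSt_metric_linear mul1r scale1r. Qed.

(** The instance [B *m U = 0] of [SpSt_metric_Omega_bar]. *)
Lemma Omega_bar_orth U D B : sp_lie B -> B *m U = 0 ->
  \tr ((Omega_bar U D)^T *m B) = 0.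
Proof.
move=> Bsp BU0; have := SpSt_metric_Omega_bar U D Bsp.
rewrite BU0 SpSt_metricE linear0 => /esym/eqP.
by rewrite mulf_eq0 invr_eq0 pnatr_eq0/= => /eqP.
Qed.

(** The difference of two candidates is vertical and orthogonal to the vertical
    matrices, hence to itself. *)
Lemma Omega_bar_unique U D A : SpSt U -> SpSt_tangent U D -> sp_lie A ->
  A *m U = D ->
  (forall B, sp_lie B -> B *m U = 0 -> \tr (A^T *m B) = 0) ->
  A = Omega_bar U D.
Proof.
move=> USt DT Asp AU Aorth; apply/eqP; rewrite -subr_eq0; apply/eqP.
set B := A - _; have Bsp : sp_lie B by exact/sp_lieB/Omega_bar_sp.
have BU : B *m U = 0 by rewrite /B mulmxDl mulNmx AU Omega_bar_mul// subrr.
apply: mxtrace_mulTmx_eq0.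
have -> : B^T = A^T - (Omega_bar U D)^T by rewrite linearB.
rewrite mulmxBl linearB/=.
by rewrite Aorth// Omega_bar_orth// subrr.
Qed.

(** The horizontal matrix of [A *m U] is the orthogonal projection of [A], and a
    projection does not increase norms. *)
Lemma SpSt_metric_le U A : SpSt U -> sp_lie A ->
  SpSt_metric U (A *m U) (A *m U) <= 2^-1 * \tr (A^T *m A).
Proof.
move=> USt Asp; rewrite SpSt_metric_Omega_bar// ler_pM2l ?invr_gt0//.
set W := Omega_bar _ _.
have Wsp : sp_lie W by exact/Omega_bar_sp/sp_lie_tangent.
have Bsp := sp_lieB Asp Wsp.
have BU : (A - W) *m U = 0.
  by rewrite mulmxDl mulNmx Omega_bar_mul// subrr.
have := mxtrace_mulTmx_le (Omega_bar_orth (A *m U) Bsp BU).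
rewrite [_ + (A - _)]addrC subrK -/W; apply: le_trans.
have := Omega_bar_orth (A *m U) Bsp BU; rewrite mulmxBr linearB/= => /eqP.
by rewrite subr_eq0 => /eqP ->.
Qed.

Lemma SpSt_metric_nondeg U D : SpSt U -> SpSt_tangent U D ->
  (forall B, sp_lie B -> SpSt_metric U D (B *m U) = 0) -> D = 0.
Proof.
move=> USt DT D0; have Wsp := Omega_bar_sp DT.
have /eqP := D0 _ Wsp; rewrite SpSt_metric_Omega_bar// mulf_eq0 invr_eq0.
rewrite pnatr_eq0/= => /eqP/mxtrace_mulTmx_eq0 W0.
by rewrite -(Omega_bar_mul D USt) W0 mul0mx.
Qed.

End HorizontalLift.

Local Opaque Omega_bar SpSt_metric.

(** * Momentum of a curve for a Levi-Civita connection *)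

Section Geodesics.
Variables (R : realType) (n k : nat).
Implicit Types (x X Y Z : 'M[R]_(n + n, k + k)) (A B : 'M[R]_(n + n)).
Local Notation St := (@SpSt R n k).
Local Notation T := (@SpSt_tangent R n k).
Local Notation g := (@SpSt_metric R n k).

Lemma velocity_tangent (I : set R) (c : R -> 'M[R]_(n + n, k + k)) t :
  open I -> smooth_curve_on St I c -> I t -> T (c t) (derive1 c t).
Proof.
move=> oI [cI cSt] It; have dc := smooth_on_is_derive cI It.
have d0 : is_derive t 1 (fun s => sympl_inv (c s) *m c s) 0.
  apply: (@near_eq_is_derive _ _ _ (cst 1%:M)).
  by apply: filterS (open_nbhs_nbhs (conj oI It)) => s /cSt cs; rewrite /= cs.
have := is_derive1E
  (is_derive_mulmx (is_derive_linear (@sympl_inv R n k) dc) dc).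
rewrite (is_derive1E d0) => /esym/eqP.
rewrite addr_eq0 /SpSt_tangent /sp_lie/= => /eqP <-.
by rewrite sympl_invM sympl_invK.
Qed.

Section LeviCivita.
Variable Gamma : 'M[R]_(n + n, k + k) -> 'M[R]_(n + n, k + k) ->
  'M[R]_(n + n, k + k) -> 'M[R]_(n + n, k + k).
Hypothesis LC : is_levi_civita St T g Gamma.

(** Along the orbit [c s = exp(s B) x] the field [V s = A *m c s] has velocity
    [A *m B *m x] at [0]; by symmetry of [Gamma], the claim is that the squared
    norm of [V] is stationary there.  It is even maximal there, by
    [SpSt_metric_le], because [A] is horizontal at [x]. *)
Lemma levi_civita_horizontal x X B : St x -> T x X -> sp_lie B ->
  let A := Omega_bar x X in
  g x X (A *m B *m x + Gamma x X (B *m x)) = 0.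
Proof.
move=> xSt XT Bsp A; have Asp : sp_lie A by exact: Omega_bar_sp.
have Ax : A *m x = X by exact: Omega_bar_mul.
pose c s := expmx (s *: B) *m x; pose V s := A *m c s.
have cE : c = expmx_curve 0 B 1%:M x.
  by rewrite expmx_curve0E; apply/funext => s; rewrite mul1mx.
have VE : V = expmx_curve 0 B A x by rewrite expmx_curve0E.
have c0 : c 0 = x by rewrite /c scale0r expmx0 mul1mx.
have cSt s : St (c s) by exact: SpSt_expmx_mul.
have curv : smooth_curve_on St setT c.
  split=> // m t _; rewrite cE.
  exact: (@smooth_expmx_curve _ _ _ _ _ _ _ setT).
have field : tangent_field_on T setT c V.
  split=> [m t _|s _]; last exact: sp_lie_tangent.
  by rewrite VE; exact: (@smooth_expmx_curve _ _ _ _ _ _ _ setT).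
have [_ Gsym _ Gmetric] := LC.
have dg := Gmetric _ _ _ _ openT curv field field.
have gX : g x X X = 2^-1 * \tr (A^T *m A).
  by rewrite -{2}Ax SpSt_metric_Omega_bar.
have d0 : is_derive (0 : R) 1 (fun s => g (c s) (V s) (V s)) 0.
  apply: (@derive1_at_max R _ (-1) 1 0).
  - by rewrite -subr_ge0 opprK.
  - by move=> t _; case: (dg t I).
  - by rewrite in_itv/= ltrN10 ltr01.
  - move=> t _; have := SpSt_metric_le (cSt t) Asp; rewrite -/(V t).
    by rewrite /V c0 Ax gX.
have := is_derive1E (dg 0 I); rewrite (is_derive1E d0) c0.
rewrite /covariant_derivative c0.
have -> : derive1 c 0 = B *m x.
  rewrite cE (is_derive1E (is_derive_expmx_curve _ _ _ _ _)).
  by rewrite mul0mx add0r mul1mx expmx_curve0E scale0r expmx0 mul1mx.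
have -> : derive1 V 0 = A *m B *m x.
  rewrite VE (is_derive1E (is_derive_expmx_curve _ _ _ _ _)).
  by rewrite mul0mx add0r expmx_curve0E scale0r expmx0 mul1mx.
rewrite /V c0 Ax Gsym//; last exact: sp_lie_tangent.
rewrite SpSt_metric_sym -mulr2n => /esym/eqP.
by rewrite mulrn_eq0/= => /eqP.
Qed.

(** The quantity [\tr (A^T *m B)] is twice the momentum [g c c' (B c)].  Metric
    compatibility produces the first term of its derivative, and
    [levi_civita_horizontal] reduces the other one to the bracket of [B] and
    [A]. *)
Lemma levi_civita_momentum (I : set R) (c : R -> 'M[R]_(n + n, k + k)) t B :
  open I -> smooth_curve_on St I c -> I t -> sp_lie B ->
  let A := Omega_bar (c t) (derive1 c t) in
  is_derive t 1 (fun s => \tr ((Omega_bar (c s) (derive1 c s))^T *m B))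
    (2 * g (c t) (covariant_derivative Gamma c (derive1 c) t) (B *m c t) +
     \tr ((A *m A^T - A^T *m A)^T *m B)).
Proof.
move=> oI curv It Bsp A.
have [cI cSt] := curv.
set x := c t in A *; set X := derive1 c t in A *.
have xSt : St x by exact: cSt.
have XT : T x X by exact: velocity_tangent oI curv It.
have Asp : sp_lie A by exact: Omega_bar_sp.
have Ax : A *m x = X by exact: Omega_bar_mul.
have fieldB : tangent_field_on T I c (fun s => B *m c s).
  by split=> [|s Is]; [exact: smooth_on_mulmx|exact: sp_lie_tangent].
have field : tangent_field_on T I c (derive1 c).
  split=> [|s Is]; first exact: smooth_on_derive1.
  exact: velocity_tangent oI curv Is.
have [_ _ _ Gmetric] := LC.
have := Gmetric _ _ _ _ oI curv field fieldB t It => dg.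
have -> : (fun s => \tr ((Omega_bar (c s) (derive1 c s))^T *m B)) =
    2 *: (fun s => g (c s) (derive1 c s) (B *m c s)).
  apply/funext => s; rewrite -[RHS]/(2 * _) SpSt_metric_Omega_bar//.
  by rewrite mulrA divff ?mul1r// pnatr_eq0.
apply: is_derive_eq; rewrite -[LHS]/(2 * _) mulrDr; congr (_ + _).
rewrite /covariant_derivative -/x -/X.
have dBc := is_derive_linear (mulmx B) (smooth_on_is_derive cI It).
rewrite (is_derive1E dBc) /=.
rewrite -/X.
(* The test vector of [levi_civita_horizontal], up to the bracket. *)
have -> : B *m X = (B *m A - A *m B) *m x + A *m B *m x.
  by rewrite mulmxBl subrK -[in LHS]Ax mulmxA.
rewrite -addrA SpSt_metricE linearD /= -SpSt_metricE.
rewrite [X in _ + X](levi_civita_horizontal xSt XT Bsp) addr0.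
rewrite SpSt_metric_Omega_bar; last exact: sp_lie_comm.
rewrite mulrA divff ?pnatr_eq0// mul1r -/A.
exact: mxtrace_comm_tr.
Qed.

End LeviCivita.

(** * The product of exponentials is a geodesic *)

Section Trajectory.
Variables (U D : 'M[R]_(n + n, k + k)).
Hypotheses (USt : St U) (DT : T U D).
Let W := Omega_bar U D.
Let S := W - W^T.
Let gamma := expmx_curve S W^T 1%:M U.
Let Wsp : sp_lie W. Proof. exact: Omega_bar_sp. Qed.
Let Ssp : sp_lie S. Proof. exact/sp_lieB/sp_lie_tr. Qed.
Let Q t := expmx (t *: S).
Let Q' t := expmx (t *: - S).

Let QT t : (Q t)^T = Q' t.
Proof. by rewrite /Q -expmx_trmx linearZ/= /S linearB/= trmxK -opprB. Qed.

Let Q'T t : (Q' t)^T = Q t. Proof. by rewrite -QT trmxK. Qed.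

Let Q'Q t : Q' t *m Q t = 1%:M. Proof. exact: expmxNK. Qed.

Lemma trajectory_SpSt t : St (gamma t).
Proof.
rewrite /gamma /expmx_curve mulmx1 -mulmxA.
by apply: SpSt_expmx_mul => //; apply: SpSt_expmx_mul => //; exact: sp_lie_tr.
Qed.

Lemma trajectory_velocity t :
  derive1 gamma t = Q t *m W *m Q' t *m gamma t.
Proof.
rewrite (is_derive1E (is_derive_expmx_curve _ _ _ _ _)) /gamma /expmx_curve.
rewrite [expmx (t *: S) *m 1%:M]mulmx1 mulmx_conj_cancel//.
by rewrite mulmx1 mul1mx /S subrK mulmxA.
Qed.

Lemma trajectory_smooth I : smooth_curve_on St I gamma.
Proof.
by split=> [|t _]; [exact: smooth_expmx_curve|exact: trajectory_SpSt].
Qed.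

(** A vertical [B] at [gamma t] is conjugated by [exp(t S) exp(t W^T)] into a
    vertical [B'] at [U], which is orthogonal to [W]. *)
Lemma trajectory_Omega_bar t :
  Omega_bar (gamma t) (derive1 gamma t) = Q t *m W *m Q' t.
Proof.
apply/esym/Omega_bar_unique; first exact: trajectory_SpSt.
- exact: (velocity_tangent openT (trajectory_smooth setT)).
- exact: sp_lie_conj.
- by rewrite trajectory_velocity.
move=> B Bsp Bg.
pose P := expmx (t *: W^T); pose P' := expmx (t *: - W^T).
pose B' := P' *m (Q' t *m B *m Q t) *m P.
have B'sp : sp_lie B'.
  have /sp_lieN WTsp := sp_lie_tr Wsp; have SNsp := sp_lieN Ssp.
  have := sp_lie_conj t WTsp (sp_lie_conj t SNsp Bsp).
  by rewrite !opprK.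
have B'U : B' *m U = 0.
  rewrite /B' -!mulmxA; have := Bg; rewrite /gamma /expmx_curve mulmx1 -mulmxA.
  by rewrite -/P -/(Q t) => ->; rewrite !mulmx0.
have PWP : P *m W^T *m P' = W^T.
  by rewrite expmx_sandwich// mulmxN subrr.
apply: (mxtrace_conj_tr (QT t) (Q'T t) PWP); rewrite -/B'.
exact: Omega_bar_orth.
Qed.

(** The momentum computed from [trajectory_Omega_bar] has the derivative that
    the Euler-Arnold equation predicts, so by [levi_civita_momentum] the
    covariant derivative of the velocity is orthogonal to the tangent space, to
    which it belongs. *)
Lemma trajectory_geodesic Gamma t : is_levi_civita St T g Gamma ->
  covariant_derivative Gamma gamma (derive1 gamma) t = 0.
Proof.
move=> LC; have curv := trajectory_smooth setT.
apply: (@SpSt_metric_nondeg R n k (gamma t)); first exact: trajectory_SpSt.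
  have [_ _ Gtan _] := LC.
  apply: (Gtan setT _ _ openT curv) => //; split=> [|s _].
    by apply: smooth_on_derive1; case: curv.
  exact: (velocity_tangent openT curv).
move=> B Bsp; have := levi_civita_momentum LC openT curv (I : setT t) Bsp.
set N := covariant_derivative _ _ _ _.
under eq_fun do rewrite trajectory_Omega_bar.
rewrite trajectory_Omega_bar; set A := Q t *m W *m Q' t => dA.
have dA' : is_derive t 1 (fun s => \tr ((Q s *m W *m Q' s)^T *m B))
    (\tr ((Q t *m (W *m W^T - W^T *m W) *m Q' t)^T *m B)).
  rewrite -mulmx_antisym_comm; apply: is_derive_mxtrace_tr.
  exact: is_derive_expmx_conj.
have KE : A *m A^T - A^T *m A = Q t *m (W *m W^T - W^T *m W) *m Q' t.
  exact: (conj_comm_tr W (QT t) (Q'T t) (Q'Q t)).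
have := is_derive1E dA'; rewrite (is_derive1E dA) KE -[X in _ = X]add0r.
by move=> /addIr/eqP; rewrite mulf_eq0 pnatr_eq0/= => /eqP.
Qed.

End Trajectory.

(** * Uniqueness of geodesics *)

(** Entries of matrices of sp are traces against matrices of sp, so the momentum
    equations determine [A'] completely. *)
Lemma geodesic_arnold (I : set R) (c : R -> 'M[R]_(n + n, k + k)) t :
  open I -> is_geodesic_on St T g I c -> I t ->
  let A := fun s => Omega_bar (c s) (derive1 c s) in
  is_derive t 1 A (A t *m (A t)^T - (A t)^T *m A t).
Proof.
move=> oI [curv [Gamma LC geo]] It A.
have Asp s : I s -> sp_lie (A s).
  by move=> Is; apply/Omega_bar_sp/(velocity_tangent oI curv Is).
set K := _ - _; have Ksp : sp_lie K.
  by apply: sp_lie_comm; [|apply: sp_lie_tr]; exact: Asp.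
have dAB B : sp_lie B ->
    is_derive t 1 (fun s => \tr ((A s)^T *m B)) (\tr (K^T *m B)).
  move=> Bsp; have := levi_civita_momentum LC oI curv It Bsp.
  have g0 x Z : g x 0 Z = 0 by rewrite SpSt_metric_sym SpSt_metricE linear0.
  by rewrite /= geo// g0 mulr0 add0r.
have spE (X : 'M[R]_(n + n)) i j : sp_lie X ->
    X i j = 2^-1 * \tr (X^T *m (delta_mx i j - sympl_inv (delta_mx i j))).
  move=> Xsp; rewrite mxtrace_sp_antisym// mxtrace_mulTmx_delta.
  by rewrite mulKf// pnatr_eq0.
apply/(is_derive_mxP A K t) => i j; rewrite (spE _ _ _ Ksp).
apply: (@near_eq_is_derive _ _ _ (fun s =>
    2^-1 *: \tr ((A s)^T *m (delta_mx i j - sympl_inv (delta_mx i j))))).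
  apply: filterS (open_nbhs_nbhs (conj oI It)) => s Is.
  by rewrite [RHS]spE//; exact: Asp.
exact/is_deriveZ/dAB/sp_lie_antisym.
Qed.

Lemma geodesic_unique (I : set R) U D (c : R -> 'M[R]_(n + n, k + k)) :
  is_geodesic_from St T g I U D c ->
  let W := Omega_bar U D in
  forall t, I t -> c t = expmx_curve (W - W^T) W^T 1%:M U t.
Proof.
move=> [[oI itvI I0] [geo c0 dc0]] W t It.
have [curv _] := geo; have [cI cSt] := curv.
rewrite -c0; apply: (arnold_trajectory itvI I0) => // s Is.
have := arnold_flow itvI I0 (fun s => @geodesic_arnold I c s oI geo) Is.
rewrite /= c0 dc0 -/W => <-; rewrite Omega_bar_mul; last exact: cSt.
exact: smooth_on_is_derive cI Is.
Qed.

End Geodesics.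

(** * Directional derivative of the metric *)

Section MetricDerivative.
Variables (R : realType) (n k : nat).
Local Notation J := (Jmx R _).
Local Notation St := (@SpSt R n k).
Local Notation g := (@SpSt_metric R n k).
Local Notation G := (@gram_inv R n k).
Implicit Types (x X Y Z : 'M[R]_(n + n, k + k)).

Definition metric_mid x : 'M[R]_(n + n) :=
  1%:M - 2^-1 *: (J^T *m (x *m G x *m x^T) *m J).

Definition gram_inv_diff x X : 'M[R]_(k + k) :=
  - (G x *m (X^T *m x + x^T *m X) *m G x).

Definition proj_diff x X : 'M[R]_(n + n) :=
  X *m G x *m x^T + x *m gram_inv_diff x X *m x^T + x *m G x *m X^T.

Definition metric_mid_diff x X : 'M[R]_(n + n) :=
  - 2^-1 *: (J^T *m proj_diff x X *m J).

(** The derivative of [x |-> g x Y Z] in the direction [X]. *)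
Definition metric_diff x X Y Z : R :=
  trform (metric_mid_diff x X) (G x) Y Z +
  trform (metric_mid x) (gram_inv_diff x X) Y Z.

Lemma SpSt_metric_trform x : g x = trform (metric_mid x) (G x).
Proof. by rewrite SpSt_metricE /metric_mid !mulmxA. Qed.

Lemma is_derive_gram_inv (c : R -> 'M[R]_(n + n, k + k)) X t :
  St (c t) -> is_derive t 1 c X ->
  is_derive t 1 (fun s => G (c s)) (gram_inv_diff (c t) X).
Proof.
move=> ct dc; apply: (is_derive_invmx (SpSt_gram_unit ct)).
exact: is_derive_mulmx (is_derive_linear (@trmx R _ _) dc) dc.
Qed.

Lemma is_derive_metric_mid (c : R -> 'M[R]_(n + n, k + k)) X t :
  St (c t) -> is_derive t 1 c X ->
  is_derive t 1 (fun s => metric_mid (c s)) (metric_mid_diff (c t) X).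
Proof.
move=> ct dc; have dG := is_derive_gram_inv ct dc.
have dcT := is_derive_linear (@trmx R _ _) dc.
have d1 := is_derive_mulmx (is_derive_mulmx dc dG) dcT.
have d2 := is_derive_linear (mulmxr J) (is_derive_linear (mulmx J^T) d1).
have d3 := is_deriveB (is_derive_cst (1%:M : 'M[R]_(n + n)) t 1)
  (is_deriveZ 2^-1 d2).
apply: (is_derive_eq d3).
by rewrite /metric_mid_diff /proj_diff sub0r scaleNr /= (mulmxDl (X *m _)).
Qed.

Lemma is_derive_SpSt_metric (c V W : R -> 'M[R]_(n + n, k + k)) c' V' W' t :
  St (c t) -> is_derive t 1 c c' -> is_derive t 1 V V' -> is_derive t 1 W W' ->
  is_derive t 1 (fun s => g (c s) (V s) (W s))
    (metric_diff (c t) c' (V t) (W t) + g (c t) V' (W t) + g (c t) (V t) W').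
Proof.
move=> ct dc dV dW; under eq_fun do rewrite SpSt_metric_trform.
have dG := is_derive_gram_inv ct dc; have dM := is_derive_metric_mid ct dc.
have dVT := is_derive_linear (@trmx R _ _) dV.
have d := is_derive_mulmx (is_derive_mulmx (is_derive_mulmx dVT dM) dW) dG.
apply: (is_derive_eq (is_derive_mxtrace d)).
rewrite !SpSt_metric_trform /metric_diff /trform.
rewrite !mulmxDl !linearD/=. lra.
Qed.

Lemma trform_linear_mid a (P P' : 'M[R]_(n + n)) (Q : 'M[R]_(k + k)) Y Z :
  trform (a *: P + P') Q Y Z = a * trform P Q Y Z + trform P' Q Y Z.
Proof.
by rewrite /trform mulmxDr !mulmxDl -scalemxAr -!scalemxAl mxtraceD mxtraceZ.
Qed.

Lemma trform_linear_gram a (P : 'M[R]_(n + n)) (Q Q' : 'M[R]_(k + k)) Y Z :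
  trform P (a *: Q + Q') Y Z = a * trform P Q Y Z + trform P Q' Y Z.
Proof. by rewrite /trform mulmxDr -scalemxAr mxtraceD mxtraceZ. Qed.

Lemma gram_inv_diff_is_linear x : linear (gram_inv_diff x).
Proof.
move=> a X X'; rewrite /gram_inv_diff [(_ + _)^T]linearP/= !(mulmxDl, mulmxDr).
rewrite -!(scalemxAl, scalemxAr) scalerN -opprD; congr (- _).
by rewrite scalerDr addrACA.
Qed.

HB.instance Definition _ x := GRing.isLinear.Build R
  'M[R]_(n + n, k + k) 'M[R]_(k + k) _ (gram_inv_diff x)
  (gram_inv_diff_is_linear x).

Lemma proj_diff_is_linear x : linear (proj_diff x).
Proof.
move=> a X X'; rewrite /proj_diff [(_ + _)^T]linearP/= linearP/=.
have sum3 (A A' B B' C C' : 'M[R]_(n + n)) :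
    a *: A + A' + (a *: B + B') + (a *: C + C') =
    a *: (A + B + C) + (A' + B' + C').
  rewrite !scalerDr [a *: A + A' + _]addrACA.
  by rewrite [LHS]addrACA.
rewrite -sum3; congr (_ + _ + _).
- by rewrite !mulmxDl -!scalemxAl.
- by rewrite mulmxDr mulmxDl -scalemxAr -scalemxAl.
- by rewrite mulmxDr -scalemxAr.
Qed.

HB.instance Definition _ x := GRing.isLinear.Build R
  'M[R]_(n + n, k + k) 'M[R]_(n + n) _ (proj_diff x) (proj_diff_is_linear x).

Lemma metric_mid_diff_is_linear x : linear (metric_mid_diff x).
Proof.
move=> a X X'; rewrite /metric_mid_diff linearP mulmxDr mulmxDl.
by rewrite -scalemxAr -scalemxAl scalerDr !scalerA mulrC.
Qed.

HB.instance Definition _ x := GRing.isLinear.Build R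
  'M[R]_(n + n, k + k) 'M[R]_(n + n) _ (metric_mid_diff x)
  (metric_mid_diff_is_linear x).

Lemma metric_diff_linear_dir x a X X' Y Z :
  metric_diff x (a *: X + X') Y Z =
  a * metric_diff x X Y Z + metric_diff x X' Y Z.
Proof.
rewrite /metric_diff !linearP trform_linear_mid trform_linear_gram.
by rewrite mulrDr addrACA.
Qed.

Lemma metric_diff_linear x X Y a Z Z' :
  metric_diff x X Y (a *: Z + Z') =
  a * metric_diff x X Y Z + metric_diff x X Y Z'.
Proof. by rewrite /metric_diff !linearP mulrDr addrACA. Qed.

Lemma metric_diff_sym x X Y Z : metric_diff x X Y Z = metric_diff x X Z Y.
Proof.
have dGT : (gram_inv_diff x X)^T = gram_inv_diff x X.
  rewrite /gram_inv_diff linearN/= !trmx_mul gram_inv_tr linearD/= !trmx_mul.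
  by rewrite !trmxK mulmxA [X in _ *m X *m _]addrC.
have MT : (metric_mid x)^T = metric_mid x.
  rewrite /metric_mid linearB/= trmx1 linearZ/= !trmx_mul !trmxK gram_inv_tr.
  by rewrite !mulmxA.
have dPT : (proj_diff x X)^T = proj_diff x X.
  rewrite /proj_diff !linearD/= !trmx_mul !trmxK gram_inv_tr dGT !mulmxA.
  by rewrite [LHS]addrC [X in _ + X = _]addrC addrA.
have dMT : (metric_mid_diff x X)^T = metric_mid_diff x X.
  by rewrite /metric_mid_diff linearZ/= !trmx_mul trmxK dPT mulmxA.
rewrite /metric_diff [in LHS]trform_sym ?gram_inv_tr//.
by rewrite [X in _ + X]trform_sym.
Qed.

End MetricDerivative.

(** * Existence of the Levi-Civita connection *)

Section LeviCivitaExistence.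
Variables (R : realType) (n k : nat).
Local Notation St := (@SpSt R n k).
Local Notation T := (@SpSt_tangent R n k).
Local Notation g := (@SpSt_metric R n k).
Implicit Types (x X Y Z : 'M[R]_(n + n, k + k)).

(** This cancels the normal component of the derivative of a tangent field: for
    [V] along [c], differentiating the tangency condition shows that
    [derive1 V t + normal_part (c t) (derive1 c t) (V t)] is tangent. *)
Definition normal_part x X Y : 'M[R]_(n + n, k + k) :=
  2^-1 *: (x *m (sympl_inv X *m Y + sympl_inv Y *m X)).

Definition koszul x X Y Z : R :=
  2^-1 * (metric_diff x X Y Z + metric_diff x Y X Z - metric_diff x Z X Y).

(** A tangent vector that represents the form [Z |-> \tr (L^T *m Z)] for the
    metric: twice the projection onto sp of [L *m x^T], applied to [x]. *)
Definition tangent_riesz x (L : 'M[R]_(n + n, k + k)) :=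
  (L *m x^T - sympl_inv (L *m x^T)) *m x.

Definition christoffel_form x X Y Z : R :=
  koszul x X Y Z - g x (normal_part x X Y) Z.

(** The tangent correction is chosen so that pairing the sum with a tangent
    vector gives the Koszul form ([christoffel_metric]). *)
Definition christoffel x X Y :=
  normal_part x X Y +
  tangent_riesz x (\matrix_(i, j) christoffel_form x X Y (delta_mx i j)).

(** The matrix [C] applied to [x] in [tangent_riesz] is horizontal, since
    pairing it with [B'] only involves [B' *m x]; so it is its own
    [Omega_bar], and [SpSt_metric_Omega_bar] computes the metric. *)
Lemma tangent_rieszP x L Z : St x -> T x Z ->
  g x (tangent_riesz x L) Z = \tr (L^T *m Z).
Proof.
move=> xSt ZT; rewrite -(Omega_bar_mul Z xSt); have := Omega_bar_sp ZT.
move: (Omega_bar x Z) => B Bsp; rewrite SpSt_metric_Omega_bar//.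
rewrite /tangent_riesz; set C := _ - _; have Csp : sp_lie C.
  exact: sp_lie_antisym.
have trC B' : sp_lie B' -> \tr (C^T *m B') = 2 * \tr ((B' *m x)^T *m L).
  move=> B'sp; rewrite mxtrace_mulTmx_sym mxtrace_sp_antisym// mulmxA.
  by rewrite mxtrace_mulC mulmxA trmx_mul.
rewrite -(@Omega_bar_unique _ _ _ x (C *m x) C)//; last 2 first.
- exact: sp_lie_tangent.
- by move=> B' B'sp B'x; rewrite trC// B'x trmx0 mul0mx linear0 mulr0.
by rewrite trC// mulKf ?pnatr_eq0// mxtrace_mulTmx_sym.
Qed.

Lemma christoffel_form_is_scalar x X Y : scalar (christoffel_form x X Y).
Proof.
move=> a Z Z'; rewrite /christoffel_form /koszul metric_diff_linear_dir.
rewrite !metric_diff_linear SpSt_metric_linear.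
move: (g x _ Z) (g x _ Z') => u u'.
move: (metric_diff x X Y Z) (metric_diff x X Y Z') => v v'.
move: (metric_diff x Y X Z) (metric_diff x Y X Z') => w w'.
move: (metric_diff x Z X Y) (metric_diff x Z' X Y) => y y'.
ring.
Qed.

HB.instance Definition _ x X Y := GRing.isLinear.Build R
  'M[R]_(n + n, k + k) R *%R (christoffel_form x X Y)
  (christoffel_form_is_scalar x X Y).

Lemma christoffel_metric x X Y Z : St x -> T x Z ->
  g x (christoffel x X Y) Z = koszul x X Y Z.
Proof.
move=> xSt ZT; rewrite /christoffel SpSt_metricDl.
rewrite tangent_rieszP// mxtrace_mulTmx_grad /christoffel_form.
by rewrite addrC subrK.
Qed.

Lemma christoffel_sym x X Y : christoffel x X Y = christoffel x Y X.
Proof.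
have NS : normal_part x X Y = normal_part x Y X.
  by rewrite /normal_part [X in _ *m X]addrC.
rewrite /christoffel NS; congr (_ + tangent_riesz _ _).
apply/matrixP => i j; rewrite !mxE /christoffel_form NS /koszul.
by rewrite (metric_diff_sym _ _ X Y) (addrC (metric_diff x X Y _)).
Qed.

Lemma christoffel_linear x a X X' Y :
  christoffel x (a *: X + X') Y = a *: christoffel x X Y + christoffel x X' Y.
Proof.
have NL : normal_part x (a *: X + X') Y =
    a *: normal_part x X Y + normal_part x X' Y.
  rewrite /normal_part [sympl_inv (_ + _)]linearP/= mulmxDl -scalemxAl.
  rewrite (mulmxDr (sympl_inv Y)) -scalemxAr addrACA -scalerDr.
  by rewrite (mulmxDr x (a *: _)) -scalemxAr scalerDr !scalerA mulrC.
have rieszL L L' : tangent_riesz x (a *: L + L') =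
    a *: tangent_riesz x L + tangent_riesz x L'.
  rewrite /tangent_riesz [(a *: L + L') *m _]mulmxDl -scalemxAl.
  rewrite [sympl_inv (_ + _)]linearP/= opprD addrACA -scalerBr.
  by rewrite [LHS]mulmxDl -scalemxAl.
rewrite /christoffel NL scalerDr addrACA -rieszL; congr (_ + tangent_riesz _ _).
apply/matrixP => i j; rewrite !mxE /christoffel_form NL SpSt_metric_linear_l.
move: (delta_mx i j) => Z; rewrite /koszul metric_diff_linear_dir.
rewrite !(metric_diff_sym x _ (a *: X + X')) !metric_diff_linear.
rewrite !(metric_diff_sym x _ X) !(metric_diff_sym x _ X').
move: (metric_diff x X Y Z) (metric_diff x X' Y Z) => v v'.
move: (metric_diff x Y Z X) (metric_diff x Y Z X') => w w'.
move: (metric_diff x Z Y X) (metric_diff x Z Y X') => y y'.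
move: (g x (normal_part x X Y) Z) (g x (normal_part x X' Y) Z) => u u'.
ring.
Qed.

Lemma christoffel_tangent I c V t : open I -> smooth_curve_on St I c ->
  tangent_field_on T I c V -> I t ->
  T (c t) (covariant_derivative christoffel c V t).
Proof.
move=> oI curv [VI VT] It; have [cI cSt] := curv.
have dc := smooth_on_is_derive cI It; have dV := smooth_on_is_derive VI It.
rewrite /covariant_derivative /christoffel addrA.
set x := c t in dc dV *; set X := derive1 c t in dc *.
set V' := derive1 V t in dV *; set Y := V t in dV *.
have xx : sympl_inv x *m x = 1%:M by exact: cSt.
(* The derivative of the tangency condition [P + sympl_inv P = 0], for
   [P = sympl_inv c *m V]. *)
have dT : sympl_inv X *m Y + sympl_inv x *m V' +
    sympl_inv (sympl_inv X *m Y + sympl_inv x *m V') = 0.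
  have d := is_derive_mulmx (is_derive_linear (@sympl_inv R n k) dc) dV.
  pose P s := sympl_inv (c s) *m V s.
  have d' : is_derive t 1 (P + (fun s => sympl_inv (P s)))
      (sympl_inv X *m Y + sympl_inv x *m V' +
       sympl_inv (sympl_inv X *m Y + sympl_inv x *m V')).
    exact: is_deriveD d (is_derive_linear (@sympl_inv R k k) d).
  have d0 : is_derive t 1 (P + (fun s => sympl_inv (P s))) 0.
    apply: (@near_eq_is_derive _ _ _ (cst 0)).
    apply: filterS (open_nbhs_nbhs (conj oI It)) => s Is.
    have := VT s Is; rewrite /SpSt_tangent/= /sp_lie/= => VTs.
    by rewrite -[RHS]/(P s + sympl_inv (P s)) VTs subrr.
  by have := is_derive1E d'; rewrite (is_derive1E d0).
have TD A B : T x A -> T x B -> T x (A + B).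
  rewrite /SpSt_tangent /sp_lie/= mulmxDr linearD/= => -> ->.
  by rewrite opprD.
apply: TD; last exact/sp_lie_tangent/sp_lie_antisym.
have xN : sympl_inv x *m normal_part x X Y =
    2^-1 *: (sympl_inv X *m Y + sympl_inv Y *m X).
  by rewrite /normal_part -scalemxAr mulmxA xx mul1mx.
rewrite /SpSt_tangent /sp_lie/= mulmxDr xN.
have -> : sympl_inv Y *m X = sympl_inv (sympl_inv X *m Y).
  by rewrite sympl_invM sympl_invK.
move: dT; move: (sympl_inv X *m Y) (sympl_inv x *m V') => p q.
have half z : 2^-1 *: (z + z) = z :> 'M[R]_(k + k).
  by rewrite scalerDr -scalerDl -[2^-1]div1r -splitr scale1r.
rewrite [sympl_inv (p + q)]raddfD /= => pq0.
apply/eqP; rewrite -subr_eq0 opprK; apply/eqP.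
rewrite [sympl_inv (q + _)]raddfD/= [sympl_inv (2^-1 *: _)]linearZ/=.
rewrite [sympl_inv (p + _)]raddfD/= sympl_invK [sympl_inv p + p]addrC.
rewrite [LHS]addrACA -scalerDr half -[RHS]pq0.
by rewrite [RHS]addrACA [sympl_inv q + q]addrC [LHS]addrC.
Qed.

Local Opaque christoffel.

(** Metric compatibility is the Koszul identity
    [koszul x X Y Z + koszul x X Z Y = metric_diff x X Y Z]. *)
Lemma christoffel_levi_civita : is_levi_civita St T g christoffel.
Proof.
split=> [x X X' Y a _ _ _ _|x X Y _ _ _|I c V oI curv VT t It|].
- exact: christoffel_linear.
- exact: christoffel_sym.
- exact: christoffel_tangent oI curv VT It.
move=> I c V W oI curv fV fW t It.
have [cI cSt] := curv; have [VI VT] := fV; have [WI WT] := fW.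
have d := is_derive_SpSt_metric (cSt t It) (smooth_on_is_derive cI It)
  (smooth_on_is_derive VI It) (smooth_on_is_derive WI It).
apply: (is_derive_eq d); rewrite /covariant_derivative.
have eV := christoffel_metric (derive1 c t) (V t) (cSt t It) (WT t It).
have eW := christoffel_metric (derive1 c t) (W t) (cSt t It) (VT t It).
move: (christoffel _ _ (V t)) (christoffel _ _ (W t)) eV eW => GV GW.
move: (c t) (derive1 c t) (V t) (W t) (derive1 V t) (derive1 W t).
move=> x X Y Z Y' Z' eV eW.
rewrite SpSt_metricDl SpSt_metricDr (SpSt_metric_sym x Y GW) eV eW /koszul.
rewrite (metric_diff_sym x X Z Y).
move: (metric_diff x X Y Z) (metric_diff x Y X Z) => u v.
move: (metric_diff x Z X Y) => w.
move: (g x Y' Z) (g x Y Z') => y z.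
by field.
Qed.

End LeviCivitaExistence.

(** * Horizontal lifts to the symplectic group and the theorem *)

Section HorizontalLifts.
Variables (R : realType) (n k : nat).
Implicit Types (M X Y A B : 'M[R]_(n + n)).

Lemma Sp_mulmxV M : Sp M -> M *m sympl_inv M = 1%:M.
Proof. exact: mulmx1C. Qed.

Lemma Sp_mulmxK M A : Sp M -> A *m M *m sympl_inv M = A.
Proof. by move=> MSp; rewrite -mulmxA Sp_mulmxV// mulmx1. Qed.

Lemma Sp_tangentP M A : Sp M -> Sp_tangent M (A *m M) <-> sp_lie A.
Proof.
move=> MSp; have MV := Sp_mulmxV MSp.
rewrite /Sp_tangent /sp_lie/= (sympl_invM (sympl_inv M)) (sympl_invM A).
rewrite sympl_invK; move: (sympl_inv M) (sympl_inv A) MV => M' A' MV.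
split=> [AM|->]; last by rewrite mulmxN mulNmx mulmxA.
move: (congr1 (fun Z => M *m Z *m M') AM) => /=.
by rewrite mulmxN mulNmx !mulmxA MV !mul1mx -!(mulmxA _ M) MV !mulmx1.
Qed.

(** Right translation by [sympl_inv M] turns a lift [A *m M] into the matrix
    [A], vertical vectors into the [B] in sp with [B *m U = 0], and the
    right-invariant metric into half the trace inner product: the conditions
    become those of [Omega_bar_unique]. *)
Lemma horizontal_liftP M (U D : 'M[R]_(n + n, k + k)) X :
  Sp M -> SpSt U -> SpSt_tangent U D -> Sp_pi k M = U ->
  is_horizontal_lift M D X <-> X = Omega_bar U D *m M.
Proof.
move=> MSp USt DT MU; pose A := X *m sympl_inv M.
have XE : X = A *m M.
  by rewrite /A -mulmxA (MSp : sympl_inv M *m M = _) mulmx1.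
clearbody A; subst X.
have piE B : Sp_pi k (B *m M) = B *m U by rewrite -MU /Sp_pi mulmxA.
have gE B : Sp_metric M (A *m M) (B *m M) = 2^-1 * \tr (A^T *m B).
  by rewrite /Sp_metric !Sp_mulmxK.
split=> [[/(Sp_tangentP _ MSp) Asp AU Aorth]|AM].
  congr (_ *m M); apply: Omega_bar_unique => //; first by rewrite -piE.
  move=> B Bsp BU; have := Aorth (B *m M).
  rewrite piE BU gE => /(_ ((Sp_tangentP _ MSp).2 Bsp) erefl)/eqP.
  by rewrite mulf_eq0 invr_eq0 pnatr_eq0/= => /eqP.
have AE : A = Omega_bar U D.
  by rewrite -[A](Sp_mulmxK _ MSp) AM Sp_mulmxK.
split; first by apply/(Sp_tangentP _ MSp); rewrite AE; exact: Omega_bar_sp.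
  by rewrite piE AE Omega_bar_mul.
move=> Y YT YE.
have YM : Y = Y *m sympl_inv M *m M.
  by rewrite -mulmxA (MSp : sympl_inv M *m M = _) mulmx1.
rewrite YM gE AE Omega_bar_orth ?mulr0//.
  by apply/(Sp_tangentP _ MSp); rewrite -YM.
by rewrite -piE -YM.
Qed.

End HorizontalLifts.

Theorem proposition3p12 (R : realType) (n k : nat)
    (k_gt0 : (0 < k)%N) (k_le_n : (k <= n)%N)
    (U Delta : 'M[R]_(n + n, k + k)) (M : 'M[R]_(n + n))
    (U_SpSt : SpSt U) (Delta_tangent : SpSt_tangent U Delta)
    (M_Sp : Sp M) (M_fiber : Sp_pi k M = U) :
  let Omega := Omega_bar U Delta in
  let gamma := fun t : R => Sp_pi k (Sp_Exp M (t *: (Omega *m M))) in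
  [/\ (forall X : 'M[R]_(n + n),
         is_horizontal_lift M Delta X <-> X = Omega *m M),
      is_geodesic_from (@SpSt R n k) (@SpSt_tangent R n k) (@SpSt_metric R n k)
        setT U Delta gamma,
      (forall (I : set R) (c : R -> 'M[R]_(n + n, k + k)),
         is_geodesic_from (@SpSt R n k) (@SpSt_tangent R n k)
           (@SpSt_metric R n k) I U Delta c ->
         forall t, I t -> c t = gamma t) &
      (forall t : R,
         gamma t = expmx (t *: (Omega - Omega^T)) *m expmx (t *: Omega^T) *m U)].
Proof.
move=> Omega gamma.
have gammaE t : gamma t =
    expmx (t *: (Omega - Omega^T)) *m expmx (t *: Omega^T) *m U.
  rewrite /gamma /Sp_Exp scalemxAl Sp_mulmxK// linearZ/= -scalerBr.
  by rewrite -M_fiber /Sp_pi mulmxA.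
have gamma_curve :
    gamma = expmx_curve (Omega - Omega^T) Omega^T 1%:M U.
  by apply/funext => t; rewrite gammaE /expmx_curve mulmx1.
split=> // [X||I c geo t It].
- exact: horizontal_liftP.
- have gamma0 : gamma 0 = U by rewrite gammaE !scale0r expmx0 !mul1mx.
  split; first by split; [exact: openT|move=> ? ? ? ? ? |].
  split=> //.
    rewrite gamma_curve; split; first exact: trajectory_smooth.
    exists (@christoffel R n k); first exact: christoffel_levi_civita.
    move=> t _.
    exact: (trajectory_geodesic U_SpSt Delta_tangent t
      (@christoffel_levi_civita R n k)).
  have := trajectory_velocity U Delta 0; rewrite -gamma_curve gamma0 => ->.
  by rewrite !scale0r expmx0 mul1mx mulmx1 Omega_bar_mul.
- by rewrite gamma_curve (geodesic_unique geo It).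
Qed.
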